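(* Let $n,k,t$ be positive integers such that either $t=1$, $n\ge 2k+5$ and $k\ge 30$, or $1<t\le \frac k4-2$ and $n\ge 2k+14t$. Then every non-trivial intersecting family $\mathcal F\subset\binom{[n]}{k}$ satisfies $$\delta_t(\mathcal F)\le \binom{n-t-1}{k-t-1}-\binom{n-t-k-1}{k-t-1}.$$
   Context: $[n]=\{1,\dots,n\}$ and $\binom{[n]}{k}$ is the set of $k$-element subsets of $[n]$. A family $\mathcal F$ is intersecting if any two of its sets intersect, and it is non-trivial if $\bigcap_{F\in\mathcal F}F=\emptyset$. For $S\subset[n]$, its degree is the number of sets of $\mathcal F$ containing $S$; $\delta_t(\mathcal F)$ is the minimum degree of a $t$-element subset of $[n]$. *)

(* Defs.v *)
From mathcomp Require Import all_boot.

Set Implicit Arguments.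
Unset Strict Implicit.
Unset Printing Implicit Defensive.

Section Families.

Variable T : finType.
Implicit Types (F : {set {set T}}) (A B S : {set T}).

Definition uniform (k : nat) F : Prop := forall A, A \in F -> #|A| = k.

Definition intersecting F : Prop :=
  forall A B, A \in F -> B \in F -> A :&: B != set0.

Definition nontrivial F : Prop := \bigcap_(A in F) A = set0.

Definition degree F S : nat := #|[set A in F | S \subset A]|.

(* No degree exceeds #|F|, so the default value #|F| does not affect the
   minimum as soon as t <= #|T|; see [min_degree_attained]. *)
Definition min_degree (t : nat) F : nat :=
  \big[minn/#|F|]_(S : {set T} | #|S| == t) degree F S.

Lemma degree_le_card F S : degree F S <= #|F|.
Proof. by apply/subset_leq_card/subsetP => A; rewrite inE => /andP[]. Qed.

Lemma min_degree_le t F S : #|S| = t -> min_degree t F <= degree F S.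
Proof.
move=> cS; rewrite /min_degree.
have: S \in index_enum {set T} by rewrite mem_index_enum.
elim: (index_enum _) => // B r IHr; rewrite inE big_cons.
case/predU1P=> [<-|/IHr le_r]; first by rewrite cS eqxx geq_minl.
by case: ifP => // _; apply: leq_trans (geq_minr _ _) le_r.
Qed.

Lemma min_degree_attained t F :
  t <= #|T| -> exists2 S : {set T}, #|S| = t & min_degree t F = degree F S.
Proof.
move=> le_tT.
have [S0 cS0] : exists S0 : {set T}, #|S0| = t.
  have: 0 < #|[set S : {set T} | #|S| == t]| by rewrite card_draws bin_gt0.
  by case/card_gt0P=> S; rewrite inE => /eqP; exists S.
have [eqF|] : min_degree t F = #|F| \/
    exists2 S : {set T}, #|S| = t & min_degree t F = degree F S; last by [].
  rewrite /min_degree; elim/big_rec: _ => [|S m /eqP cS IH]; first by left.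
  by rewrite /minn; case: ifP => _ //; right; exists S.
exists S0 => //; apply/eqP; rewrite eqn_leq min_degree_le //=.
by rewrite eqF degree_le_card.
Qed.

End Families.

(* Main.v *)
Require Import Defs.
From mathcomp Require Import all_boot all_order all_algebra fingroup perm.
From mathcomp Require Import zify ring lra.

(** Let [x] be a vertex missed by the fewest sets, say by [b] sets, where
    [b > 0] because the family is non-trivial.

    If [b] is tiny, take sets [G] and [H] missing [x] and a [t]-set [S] outside
    [G], [H] and [x].  The sets through [x] and [S] must meet [G], which is the
    claimed bound, and must also meet [H], which excludes more sets than the
    [b - 2] other sets missing [x] can bring back.

    Otherwise the minimum degree is compared with the average degree of the
    [t]-sets avoiding [x], and the number of [k]-sets through [x] that are
    absent must exceed [b] by a factor [k / (k - t)] with room to spare.  If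
    [b <= 'C(n - 3, k - 2)], Kruskal-Katona applied to the sets missing [x]
    gives the factor [(n - k - 1) / (k - 1)].  If every vertex is missed by more
    than ['C(n - 3, k - 2)] sets, compress the family: either one compression
    makes this number collapse, and then the compressed pair of vertices is
    missed by few sets and Kruskal-Katona applies to the four traces on the
    pair; or a shifted family is reached, in which every set holds the majority
    of some initial segment, and local LYM beyond the first such segment gives
    the same factor. *)

Set Implicit Arguments.
Unset Strict Implicit.
Unset Printing Implicit Defensive.

(** * Compressions and shadows *)

Section Shift.

Variables (T : finType) (i j : T).
Implicit Types (F P Q : {set {set T}}) (A B : {set T}) (k l : nat).

Definition swap A : {set T} := tperm i j @^-1: A.

Lemma swapK : involutive swap.
Proof. by move=> A; apply/setP=> x; rewrite !inE tpermK. Qed.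

Lemma card_swap A : #|swap A| = #|A|.
Proof. exact/card_preimset/perm_inj. Qed.

Lemma mem_swapL A : (i \in swap A) = (j \in A).
Proof. by rewrite inE tpermL. Qed.

Lemma mem_swapR A : (j \in swap A) = (i \in A).
Proof. by rewrite inE tpermR. Qed.

Lemma swap_id A : (i \in A) = (j \in A) -> swap A = A.
Proof. by move=> eqA; apply/setP=> x; rewrite inE; case: tpermP => [->|->|]. Qed.

Lemma swap0 : swap set0 = set0.
Proof. exact: preimset0. Qed.

Lemma swapI A B : swap (A :&: B) = swap A :&: swap B.
Proof. exact: preimsetI. Qed.

Lemma swapS A B : A \subset B -> swap A \subset swap B.
Proof. exact: preimsetS. Qed.

(* The compression replacing [j] by [i], stated through the involution [swap]
   so that [A] and [swap A] alone decide membership of either of them. *)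
Definition shift F : {set {set T}} :=
  [set A : {set T} | if (j \in A) && (i \notin A) then (A \in F) && (swap A \in F)
           else if (i \in A) && (j \notin A) then (A \in F) || (swap A \in F)
           else A \in F].

Lemma mem_shift F A : A \in shift F -> A \in F \/ swap A \in F.
Proof.
rewrite inE; case: ifP => _; first by case/andP; left.
by case: ifP => _; [move/orP | left].
Qed.

(** Among [A] and [swap A], equally many belong to [F] and to [shift F]. Summing this over all [A]
    counts each family twice, so no orbit representatives have to be chosen. *)
Lemma card_shift F : #|shift F| = #|F|.
Proof.
have dbl (G : {set {set T}}) :
    \sum_(A : {set T}) ((A \in G) + (swap A \in G)) = #|G| + #|G|.
  rewrite big_split /= [X in _ + X](reindex_inj (inv_inj swapK)) /=.
  under [X in _ + X]eq_bigr do rewrite swapK.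
  rewrite -sum1_card [in RHS]big_mkcond /=.
  by congr (_ + _); apply: eq_bigr => A _; case: (A \in G).
apply/eqP; rewrite -(eqn_pmul2l (isT : 0 < 2)) !mul2n -!addnn -!dbl; apply/eqP.
apply: eq_bigr => A _.
rewrite [A \in shift F]inE [swap A \in shift F]inE swapK mem_swapL mem_swapR.
have [iA|iA] := boolP (i \in A); have [jA|jA] := boolP (j \in A) => //=;
  by do 2!case: (_ \in F).
Qed.

Lemma uniform_shift k F : uniform k F -> uniform k (shift F).
Proof. by move=> uF A /mem_shift [/uF //|/uF]; rewrite card_swap. Qed.

Lemma shiftP F A : A \in shift F ->
  (A \in F /\ (i \notin A -> swap A \in F)) \/ [/\ i \in A, j \notin A & swap A \in F].
Proof.
rewrite inE; have [iA|iA] := boolP (i \in A); have [jA|jA] := boolP (j \in A) => //=.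
- by left.
- by case/orP=> HA; [left | right].
- by case/andP; left.
- by move=> AF; left; rewrite swap_id // (negbTE iA) (negbTE jA).
Qed.

(** If [A] and [B] were disjoint, so would be their swaps. Either [A], [B] or [swap A], [swap B] lie
    in the original families, unless both sets were moved, and then they share [i]. *)
Lemma shift_cross P Q :
  (forall A B, A \in P -> B \in Q -> A :&: B != set0) ->
  forall A B, A \in shift P -> B \in shift Q -> A :&: B != set0.
Proof.
move=> PQ A B sA sB; apply/negP=> /eqP AB0.
have sAB0 : swap A :&: swap B = set0 by rewrite -swapI AB0 swap0.
have nPQ C D : C \in P -> D \in Q -> C :&: D = set0 -> False.
  by move=> CP DQ; apply/eqP/PQ.
have niAB : ~~ ((i \in A) && (i \in B)) by rewrite -in_setI AB0 inE.
case: (shiftP sA) (shiftP sB) => [[AP sAP]|[iA jA AP]] [[BQ sBQ]|[iB jB BQ]].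
- exact: nPQ AP BQ AB0.
- by rewrite iB andbT in niAB; apply: nPQ (sAP niAB) BQ sAB0.
- by rewrite iA in niAB; apply: nPQ AP (sBQ niAB) sAB0.
- by rewrite iA iB in niAB.
Qed.

Definition shadow l Q : {set {set T}} :=
  [set A : {set T} | (#|A| == l) && [exists B in Q, A \subset B]].

Lemma shadowP l Q A :
  reflect (#|A| = l /\ exists2 B, B \in Q & A \subset B) (A \in shadow l Q).
Proof.
rewrite inE; apply: (iffP andP) => -[/eqP cA].
  by case/exists_inP=> B QB AB; split=> //; exists B.
by case=> B QB AB; split=> //; apply/exists_inP; exists B.
Qed.

(** The delicate case is [j] in [A] and [i] outside, where both [A] and [swap A] must lie in the
    shadow. The covering set [B] contains [j], so it was not moved, and its swap, possibly [B]
    itself, is in [Q] as well. *)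
Lemma shadow_shift l Q : shadow l (shift Q) \subset shift (shadow l Q).
Proof.
apply/subsetP=> A /shadowP[cA [B sB AB]].
have sh (C D : {set T}) : C \subset D -> #|C| = l -> D \in Q -> C \in shadow l Q.
  by move=> CD cC DQ; apply/shadowP; split=> //; exists D.
have csA : #|swap A| = l by rewrite card_swap.
have sAB := swapS AB.
rewrite inE; case: ifP => [/andP[jA iA] | _].
  have jB : j \in B by apply: (subsetP AB).
  case: (shiftP sB) => [[BQ sBQ]|[_ /negP//]].
  rewrite (sh A B) //=; have [iB|iB] := boolP (i \in B).
    by apply: (sh _ (swap B)) => //; rewrite swap_id // iB jB.
  exact: sh sAB csA (sBQ iB).
case: (shiftP sB) => [[BQ _]|[iB jB sBQ]].
  by rewrite (sh A B) //; case: ifP.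
rewrite (sh _ _ sAB csA sBQ) orbT.
have [jA|jA] := boolP (j \in A); first by rewrite (subsetP AB _ jA) in jB.
have [//|iA] := boolP (i \in A).
by rewrite -(@swap_id A) ?(negbTE iA) ?(negbTE jA) //; apply: sh sAB csA sBQ.
Qed.

Lemma card_shadow_shift l Q : #|shadow l (shift Q)| <= #|shadow l Q|.
Proof. by rewrite -(card_shift (shadow l Q)) subset_leq_card ?shadow_shift. Qed.

End Shift.

(** * The Kruskal-Katona theorem *)

Section KruskalKatona.

Variable T : finType.
Implicit Types (F P Q : {set {set T}}) (A B : {set T}) (x y : T) (k l r z : nat).

Lemma shadow_id r Q : uniform r Q -> shadow r Q = Q.
Proof.
move=> uQ; apply/setP=> A; apply/shadowP/idP => [[cA [B QB AB]]|QA].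
  by have/eqP -> : A == B by rewrite eqEcard AB (uQ _ QB) cA leqnn.
by split; [exact: uQ | exists A].
Qed.

Lemma shadow_gt0 l r Q : l <= r -> uniform r Q -> 0 < #|Q| -> 0 < #|shadow l Q|.
Proof.
move=> lr uQ /card_gt0P[B QB].
have : 0 < #|[set A : {set T} | A \subset B & #|A| == l]|.
  by rewrite cards_draws bin_gt0 (uQ _ QB).
case/card_gt0P=> A; rewrite inE => /andP[AB /eqP cA].
by apply/card_gt0P; exists A; apply/shadowP; split=> //; exists B.
Qed.

Lemma sub_shadow l P Q : P \subset Q -> shadow l P \subset shadow l Q.
Proof.
move=> /subsetP PQ; apply/subsetP=> A /shadowP[cA [B PB AB]].
by apply/shadowP; split=> //; exists B => //; apply: PQ.
Qed.

Lemma subfamily_of_card m Q : m <= #|Q| -> exists2 P : {set {set T}}, P \subset Q & #|P| = m.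
Proof.
move=> mQ; have : 0 < #|[set P : {set {set T}} | P \subset Q & #|P| == m]|.
  by rewrite cards_draws bin_gt0.
by case/card_gt0P=> P; rewrite inE => /andP[PQ /eqP]; exists P.
Qed.

Definition link x Q : {set {set T}} := [set B :\ x | B in [set B in Q | x \in B]].
Definition avoid x Q : {set {set T}} := [set B in Q | x \notin B].

Lemma mem_link x Q A : A \in link x Q = (x \notin A) && (x |: A \in Q).
Proof.
apply/imsetP/andP=> [[B]|[xA QA]].
  by rewrite inE => /andP[QB xB] ->; rewrite setD1K // !inE eqxx.
by exists (x |: A); rewrite ?setU1K // inE QA setU11.
Qed.

Lemma card_link x Q : #|link x Q| = #|[set B in Q | x \in B]|.
Proof.
apply: card_in_imset => A B; rewrite !inE => /andP[_ xA] /andP[_ xB] AB.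
by rewrite -(setD1K xA) AB setD1K.
Qed.

Lemma card_link_avoid x Q : #|link x Q| + #|avoid x Q| = #|Q|.
Proof.
rewrite card_link -(cardsID [set B : {set T} | x \in B] Q); congr (_ + _).
  by apply: eq_card => B; rewrite !inE.
by apply: eq_card => B; rewrite !inE andbC.
Qed.

Lemma uniform_link x r Q : uniform r.+1 Q -> uniform r (link x Q).
Proof.
move=> uQ A; rewrite mem_link => /andP[xA /uQ].
by rewrite cardsU1 xA => -[].
Qed.

Definition compressed x Q := forall y B, B \in Q -> y \in B -> x \notin B -> swap x y B \in Q.

(** Every effective compression towards [x] lowers the number of sets avoiding [x], so the process
    stops. *)
Lemma compress x r Q : uniform r Q ->
  exists Q', [/\ uniform r Q', #|Q'| = #|Q|, compressed x Q' &
                 forall l, #|shadow l Q'| <= #|shadow l Q|].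
Proof.
have [m] := ubnP #|avoid x Q|; elim: m Q => // m IH Q ltm uQ.
have [/exists_inP[B QB /exists_inP[y yB /andP[xB sB]]] | noB] :=
  boolP [exists B in Q, [exists y in B, (x \notin B) && (swap x y B \notin Q)]].
  have ltQ : #|avoid x (shift x y Q)| < #|avoid x Q|.
    apply: proper_card; apply/properP; split.
      apply/subsetP=> A; rewrite inE => /andP[/shiftP QA xA]; rewrite inE xA andbT.
      by case: QA => [[]//|[xA']]; rewrite xA' in xA.
    exists B; first by rewrite inE QB.
    by rewrite !inE yB xB QB (negbTE sB).
  have [|Q' [uQ' cQ' sQ' hQ']] := IH (shift x y Q) _ (uniform_shift uQ).
    exact: leq_trans ltQ _.
  exists Q'; split=> //; first by rewrite cQ' card_shift.
  by move=> l; apply: leq_trans (hQ' l) (card_shadow_shift _ _ _ _).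
exists Q; split=> // y B QB yB xB; apply: contraNT noB => sB.
by apply/exists_inP; exists B => //; apply/exists_inP; exists y; rewrite // xB.
Qed.

(** The first term counts sets of the shadow of [Q] that avoid [x], the second, after inserting [x],
    sets that contain it. *)
Lemma shadow_link x l Q :
  #|shadow l.+1 (link x Q)| + #|shadow l (link x Q)| <= #|shadow l.+1 Q|.
Proof.
have nx m A : A \in shadow m (link x Q) -> x \notin A.
  case/shadowP=> _ [B]; rewrite mem_link => /andP[xB _] AB.
  by apply: contraNN xB => /(subsetP AB).
have inj : {in shadow l (link x Q) &, injective (fun A => x |: A)}.
  by move=> A B /nx xA /nx xB AB; rewrite -(setU1K xA) AB setU1K.
rewrite -(card_in_imset inj) -cardsUI [X in _ + X](_ : _ = 0) ?addn0.
  apply/subset_leq_card/subUsetP; split; apply/subsetP=> A.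
    case/shadowP=> cA [B]; rewrite mem_link => /andP[xB QB] AB.
    apply/shadowP; split=> //; exists (x |: B) => //.
    exact: subset_trans AB (subsetU1 _ _).
  case/imsetP=> C sC ->; have xC := nx _ _ sC.
  case/shadowP: sC => cC [B]; rewrite mem_link => /andP[xB QB] AB.
  by apply/shadowP; rewrite cardsU1 xC cC; split=> //; exists (x |: B); rewrite ?setUS.
apply/eqP; rewrite cards_eq0; apply/eqP/setP=> A; rewrite in_setI in_set0.
apply/negP=> /andP[/nx xA /imsetP[C _ defA]].
by rewrite defA setU11 in xA.
Qed.

(** Deleting [y] from a set avoiding [x] and inserting [x] instead is a compression of that set,
    which stays in [Q]. *)
Lemma shadow_avoid x r Q : uniform r.+1 Q -> compressed x Q ->
  shadow r (avoid x Q) \subset link x Q.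
Proof.
move=> uQ cQ; apply/subsetP=> A /shadowP[cA [B]].
rewrite inE => /andP[QB xB] AB; rewrite mem_link.
have xA : x \notin A by apply: contraNN xB => /(subsetP AB).
rewrite xA; have : #|B :\: A| == 1 by rewrite cardsD (setIidPr AB) (uQ _ QB) cA subSnn.
case/cards1P=> y BA.
have : y \in B :\: A by rewrite BA set11.
rewrite inE => /andP[yA yB].
have defB : B = y |: A by rewrite -(setID B A) BA (setIidPr AB) setUC.
suff <- : swap x y B = x |: A by apply: cQ.
have xy : x != y by apply: contraTneq yB => <-.
apply/setP=> w; rewrite inE defB !inE.
case: tpermP => [->|->|/eqP/negbTE wx /eqP/negbTE wy].
- by rewrite !eqxx.
- by rewrite (negbTE xA) (negbTE yA) (negbTE xy) eq_sym (negbTE xy).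
- by rewrite wx wy.
Qed.

Lemma kk_trivial r l Q z : l = r \/ l = 0 -> uniform r Q -> #|Q| <= 'C(z, r) ->
  #|Q| * 'C(z, l) <= #|shadow l Q| * 'C(z, r).
Proof.
case=> [->|->] uQ hQ; first by rewrite shadow_id.
rewrite bin0 muln1; have [->//|Q0] := posnP #|Q|.
by apply: leq_trans hQ _; rewrite leq_pmull ?(shadow_gt0 (leq0n r) uQ).
Qed.

(** A subfamily of exactly ['C(z, r)] sets suffices. The small case is a premise so that the
    induction proving it can already use this form for its smaller [z]. *)
Lemma kk_large_of_small z r l Q :
  (forall Q', uniform r Q' -> #|Q'| <= 'C(z, r) ->
     #|Q'| * 'C(z, l) <= #|shadow l Q'| * 'C(z, r)) ->
  r <= z -> uniform r Q -> 'C(z, r) <= #|Q| -> 'C(z, l) <= #|shadow l Q|.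
Proof.
move=> small rz uQ hQ; have [Q' QQ' cQ'] := subfamily_of_card hQ.
have := small Q'; rewrite cQ' => /(_ _ (leqnn _)) h.
rewrite -(leq_pmul2r (_ : 0 < 'C(z, r))) ?bin_gt0 // mulnC.
apply: leq_trans (h _) _; first by move=> A /(subsetP QQ'); apply: uQ.
by rewrite leq_mul2r subset_leq_card ?orbT ?sub_shadow.
Qed.

(* Lovasz's form of Kruskal-Katona for integral [z], as one inequality that
   is linear in the size of the family. *)
Theorem kk_small z r l Q : l <= r -> uniform r Q -> #|Q| <= 'C(z, r) ->
  #|Q| * 'C(z, l) <= #|shadow l Q| * 'C(z, r).
Proof.
elim: z r l Q => [|z IH] r l Q lr uQ hQ.
  case: r l lr uQ hQ => [|r] [|l] lr uQ hQ; last 2 first.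
  - by apply: kk_trivial => //; right.
  - by move: hQ; rewrite bin0n leqn0 => /eqP ->.
  - by apply: kk_trivial => //; left.
  - by [].
case: l lr => [|l] lr; first by apply: kk_trivial => //; right.
case: r lr uQ hQ => // r lr uQ hQ.
have [/eqP l_r|l_r] := boolP (l.+1 == r.+1); first by apply: kk_trivial => //; left.
have {l_r} lr1 : l.+1 <= r by rewrite -ltnS ltn_neqAle l_r.
have [->//|/card_gt0P[B0 QB0]] := posnP #|Q|.
have [x _] : exists x, x \in B0 by apply/card_gt0P; rewrite (uQ _ QB0).
have [Q' [uQ' cQ' coQ' shQ']] := compress x uQ.
rewrite -cQ' in hQ *; apply: leq_trans (leq_mul (shQ' _) (leqnn _)).
move: Q' {QB0 shQ' cQ' uQ Q} uQ' hQ coQ' => Q uQ hQ coQ.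
have [rz|zr] := leqP r z; last first.
  by move: hQ; rewrite bin_small // leqn0 => /eqP ->.
have uL := uniform_link (x:=x) uQ.
have uA : uniform r.+1 (avoid x Q) by move=> A; rewrite inE => /andP[/uQ].
have sl := shadow_link x l Q; have sa := subset_leq_card (shadow_avoid uQ coQ).
have cQ := card_link_avoid x Q.
have large r' l' Q' : l' <= r' -> r' <= z -> uniform r' Q' ->
    'C(z, r') <= #|Q'| -> 'C(z, l') <= #|shadow l' Q'|.
  by move=> l'r'; apply: kk_large_of_small => Q''; apply: IH.
(* A link this large supplies both terms of Pascal's rule for ['C(z.+1, l.+1)] by itself. *)
have [big|small] := leqP 'C(z, r) #|link x Q|.
  have h1 := large _ _ _ lr1 rz uL big; have h2 := large _ _ _ (ltnW lr1) rz uL big.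
  rewrite mulnC leq_mul // binS; apply: leq_trans sl; exact: leq_add.
(* Otherwise the shadow of the avoiding part, which lies in the link, would have at least ['C(z, r)]
   sets. *)
have avoid_small : #|avoid x Q| <= 'C(z, r.+1).
  rewrite leqNgt; apply/negP=> big; suff : 'C(z, r) <= #|link x Q| by rewrite leqNgt small.
  have [rz'|zr] := leqP r.+1 z.
    by apply: leq_trans sa; apply: large => //; apply: ltnW.
  have -> : z = r by apply/eqP; rewrite eqn_leq rz andbT -ltnS.
  rewrite binn; apply: leq_trans sa; apply: shadow_gt0 uA _ => //.
  exact: leq_trans big.
have h1 := IH _ _ _ lr1 uL (ltnW small); have h2 := IH _ _ _ (ltnW lr1) uL (ltnW small).
have h3 := IH _ _ _ (leqnSn r) uA avoid_small.
have Cpos : 0 < 'C(z, r) by apply: leq_ltn_trans small.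
rewrite -(leq_pmul2r Cpos) !binS.
(* The avoiding part is bounded through its shadow inside the link, so the link has at least the
   share ['C(z, r) / 'C(z.+1, r.+1)] of [Q]. *)
have h4 : #|Q| * 'C(z, r) <= #|link x Q| * ('C(z, r.+1) + 'C(z, r)).
  rewrite -cQ mulnDl mulnDr addnC leq_add2r.
  by apply: leq_trans h3 _; rewrite leq_mul2r sa orbT.
rewrite mulnAC; apply: leq_trans (leq_mul h4 (leqnn _)) _.
rewrite mulnAC [X in _ <= X]mulnAC leq_mul2r; apply/orP; right.
by apply: leq_trans (leq_mul sl (leqnn _)); rewrite mulnDr mulnDl leq_add.
Qed.

Theorem kk_large z r l Q : l <= r -> r <= z -> uniform r Q ->
  'C(z, r) <= #|Q| -> 'C(z, l) <= #|shadow l Q|.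
Proof. by move=> lr; apply: kk_large_of_small => Q'; apply: kk_small. Qed.

End KruskalKatona.

(** * Traces of an intersecting family *)

(* Kruskal-Katona yields the last premise with [c / d = q / p >= M / K]. *)
Lemma cross_ratio K M p q a b c d e : M * p <= K * q -> p * c = q * d ->
  0 < d -> 0 < p -> a * d + b * c <= e * d -> K * a + M * b <= K * e.
Proof.
move=> MK pc d0 p0 h; rewrite -(leq_pmul2r d0) -(leq_pmul2r p0).
apply: (@leq_trans (K * p * (a * d + b * c))); last first.
  have -> : K * e * d * p = K * p * (e * d) by ring.
  by rewrite leq_mul2l h orbT.
have -> : K * p * (a * d + b * c) = K * a * d * p + K * b * (p * c) by ring.
have -> : K * b * (p * c) = K * q * (d * b) by rewrite pc; ring.
have -> : (K * a + M * b) * d * p = K * a * d * p + M * p * (d * b) by ring.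
by rewrite leq_add2l leq_mul2r MK orbT.
Qed.

Section Traces.

Variable T : finType.
Implicit Types (F P Q : {set {set T}}) (A B J S : {set T}) (x y : T).

(** The members are kept whole, not restricted to the complement of [J]. In particular [trace F
    [set x] set0] is the family of sets missing [x]. *)
Definition trace F J S : {set {set T}} := [set A in F | A :&: J == S].

Lemma traceP F J S A : reflect (A \in F /\ A :&: J = S) (A \in trace F J S).
Proof. by rewrite inE; apply: (iffP andP) => -[AF /eqP]. Qed.

Lemma mem_trace0 F x A : (A \in trace F [set x] set0) = (A \in F) && (x \notin A).
Proof. by rewrite inE setI_eq0 disjoint_sym disjoints1. Qed.

Lemma card_trace1 F x J S : S \subset J -> x \notin J ->
  #|trace F J S| = #|trace F (x |: J) S| + #|trace F (x |: J) (x |: S)|.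
Proof.
move=> SJ xJ; have xS : x \notin S by apply: contraNN xJ => /(subsetP SJ).
rewrite -(cardsID [set B : {set T} | x \in B]) addnC.
have AxJ A : (x |: J) :&: A = if x \in A then x |: (J :&: A) else J :&: A.
  rewrite setIUl; case: ifP => [xA|/negbT xA].
    by rewrite (setIidPl _) // sub1set.
  by rewrite (_ : [set x] :&: A = set0) ?set0U //; apply/eqP; rewrite setI_eq0 disjoints1.
have nxI A : x \notin J :&: A by rewrite inE (negbTE xJ).
congr (_ + _); apply: eq_card => A; rewrite !inE ![A :&: _]setIC AxJ;
  case: ifP => xA; rewrite ?andbT ?andbF //.
- apply/esym/negbTE; rewrite negb_and; apply/orP; right.
  by apply: contraNneq xS => <-; rewrite setU11.
- congr (_ && _); apply/eqP/eqP => [->//|e].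
  by rewrite -(setU1K (nxI A)) e setU1K.
- apply/esym/negbTE; rewrite negb_and; apply/orP; right.
  by apply: contraNneq (nxI A) => ->; rewrite setU11.
Qed.

Lemma card_trace_le k F J S : uniform k F -> #|trace F J S| <= 'C(#|T| - #|J|, k - #|S|).
Proof.
move=> uF; have inj : {in trace F J S &, injective (fun A => A :\: J)}.
  move=> A B /traceP[_ AJ] /traceP[_ BJ] AB.
  by rewrite -(setID A J) -(setID B J) AJ BJ AB.
rewrite -(card_in_imset inj) -[X in 'C(X - _, _)](cardsC J) addKn -cards_draws.
apply/subset_leq_card/subsetP=> _ /imsetP[A /traceP[FA AJ] ->].
by rewrite inE setDE subsetIr -setDE -(uF _ FA) -AJ -(cardsID J A) addKn eqxx.
Qed.

Section Cross.

Variables (F J S S' : _) (k p r N : nat).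
Hypotheses (uF : uniform k F) (iF : intersecting F) (SS' : S :&: S' = set0).
Hypotheses (pS : p + #|S| = k) (rS' : r + k + #|J| = #|T| + #|S'|)
           (NJ : N + #|J| = #|T|).

(** Outside [J] there are [N] points. There a set with trace [S] has [p] elements, and the
    complement of a set with trace [S'] has [r]. *)
Let Qc : {set {set T}} := [set ~: (J :|: B) | B in trace F J S'].

Lemma trace_compl_card : #|Qc| = #|trace F J S'|.
Proof.
apply: card_in_imset => A B; rewrite !inE => /andP[_ /eqP AJ] /andP[_ /eqP BJ] /setC_inj AB.
apply/setP=> y; move/setP/(_ y): AB; move/setP/(_ y): AJ; rewrite -BJ !inE.
by case: (y \in J); rewrite ?andbT.
Qed.

Lemma trace_card_diff A : A \in trace F J S' -> #|A :\: J| + #|S'| = k.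
Proof. by case/traceP=> AF <-; rewrite addnC cardsID; apply: uF. Qed.

Lemma trace_compl_uniform : uniform r Qc.
Proof.
move=> _ /imsetP[B sB ->]; have := trace_card_diff sB; have := cardsC (J :|: B).
by rewrite -(cardsID J (J :|: B)) setUK setDUl setDv set0U; lia.
Qed.

(** Since [S] and [S'] are disjoint, a set with trace [S] must meet a set with trace [S'] outside
    [J]. Its tail is therefore not contained in a member of [Qc], so tails and shadow are disjoint
    families of [p]-sets. *)
Lemma trace_shadow : #|trace F J S| + #|shadow p Qc| <= 'C(N, p).
Proof.
have cN : #|~: J| = N by rewrite cardsCs setCK -NJ addnK.
have inj : {in trace F J S &, injective (fun A => A :\: J)}.
  move=> A B /traceP[_ AJ] /traceP[_ BJ] AB.
  by rewrite -(setID A J) -(setID B J) AJ BJ AB.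
rewrite -(card_in_imset inj) -cN -cards_draws.
rewrite -cardsUI [X in _ + X](_ : _ = 0) ?addn0.
  apply/subset_leq_card/subUsetP; split; apply/subsetP=> A.
    case/imsetP=> B /traceP[FB BJ] ->; rewrite inE setDE subsetIr /=.
    by rewrite -setDE -(eqn_add2l #|B :&: J|) cardsID (uF FB) BJ addnC pS.
  case/shadowP=> cA [_ /imsetP[B _ ->] AB]; rewrite inE cA eqxx andbT.
  by rewrite (subset_trans AB) // setCS subsetUl.
apply/eqP; rewrite cards_eq0; apply/eqP/setP=> D; rewrite in_setI in_set0.
apply/negP=> /andP[/imsetP[A /traceP[FA AJ] ->]].
case/shadowP=> _ [_ /imsetP[B /traceP[FB BJ] ->] sub].
have := iF FA FB; apply/negP; rewrite negbK; apply/eqP/setP=> y; rewrite !inE.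
apply/negP=> /andP[yA yB]; have [yJ|yJ] := boolP (y \in J).
  by move/setP/(_ y): SS'; rewrite -AJ -BJ !inE yA yB yJ.
have /(subsetP sub) : y \in A :\: J by rewrite inE yJ.
by rewrite !inE yB orbT.
Qed.

Lemma trace_cross_small z : p <= r -> #|trace F J S'| <= 'C(z, r) ->
  #|trace F J S| * 'C(z, r) + #|trace F J S'| * 'C(z, p) <= 'C(N, p) * 'C(z, r).
Proof.
move=> pr; rewrite -trace_compl_card => /(kk_small pr trace_compl_uniform) h.
by apply: leq_trans (leq_mul trace_shadow (leqnn _)); rewrite mulnDl leq_add2l.
Qed.

Lemma trace_cross_large z : p <= r -> r <= z -> 'C(z, r) <= #|trace F J S'| ->
  #|trace F J S| + 'C(z, p) <= 'C(N, p).
Proof.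
move=> pr rz; rewrite -trace_compl_card => /(kk_large pr rz trace_compl_uniform) h.
by apply: leq_trans trace_shadow; rewrite leq_add2l.
Qed.

End Cross.

End Traces.

(** * Shifted families *)

Section Shifted.

Variables (n k : nat) (F : {set {set 'I_n}}).
Implicit Types (A B S : {set 'I_n}) (x y z : 'I_n) (m : nat).
Hypotheses (uF : uniform k F) (iF : intersecting F) (le2kn : 2 * k <= n).
Hypothesis shF : forall z y B, z < y -> B \in F -> y \in B -> z \notin B -> swap z y B \in F.

Definition initial m : {set 'I_n} := [set y : 'I_n | y < m].

Lemma card_initial m : m <= n -> #|initial m| = m.
Proof.
move=> mn; rewrite -sum1_card -[RHS]card_ord -sum1_card (big_ord_widen n (fun=> 1) mn).
by apply: eq_bigl => y; rewrite inE.
Qed.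

Lemma initialS m (lt_mn : m < n) : initial m.+1 = Ordinal lt_mn |: initial m.
Proof. by apply/setP=> y; rewrite !inE ltnS leq_eqVlt. Qed.

Lemma initialS_notin m (lt_mn : m < n) : Ordinal lt_mn \notin initial m.
Proof. by rewrite inE ltnn. Qed.

Lemma shifted_majority B : B \in F -> exists2 m, m <= n & m < 2 * #|B :&: initial m|.
Proof.
move=> BF; have [/existsP[m hm]|no] := boolP [exists m : 'I_n.+1, m < 2 * #|B :&: initial m|].
  by exists m; first by rewrite -ltnS.
have nohit m : m <= n -> 2 * #|B :&: initial m| <= m.
  rewrite -ltnS => mn; rewrite leqNgt.
  by move: no; rewrite negb_exists => /forallP/(_ (Ordinal mn)).
(* Push the elements of [B] to the left into the complement of [B], smallest
   first.  There is room because [B] never holds a majority, and the result is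
   disjoint from [B]. *)
have inv m : m <= n -> exists B', [/\ B' \in F, B' :&: B :&: initial m = set0,
    #|B' :&: initial m| = #|B :&: initial m| & forall y, m <= y -> (y \in B') = (y \in B)].
  elim: m => [|m IH] mn.
    by exists B; split=> //; apply/setP=> y; rewrite !inE andbF.
  have [B' [FB' disj cB' eqB]] := IH (ltnW mn); pose y := Ordinal mn.
  have ym : y \notin initial m := initialS_notin mn.
  have cap C : C :&: initial m.+1 = if y \in C then y |: (C :&: initial m) else C :&: initial m.
    rewrite initialS -/y setIUr; case: ifP => [yC|/negbT yC].
      by rewrite (setIidPr _) // sub1set.
    by rewrite (_ : C :&: [set y] = set0) ?set0U // setIC; apply/eqP; rewrite setI_eq0 disjoints1.
  have yC C : y \notin C :&: initial m by rewrite inE (negbTE ym) andbF.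
  have eqy : (y \in B') = (y \in B) by rewrite eqB //=.
  have [yB|yB] := boolP (y \in B); last first.
    exists B'; split=> //; rewrite ?cap.
    - by rewrite inE eqy (negbTE yB).
    - by rewrite eqy (negbTE yB).
    - by move=> w wm; rewrite eqB // ltnW.
  have cB : #|B :&: initial m.+1| = #|B :&: initial m|.+1 by rewrite cap yB cardsU1 yC.
  have : ~~ (initial m \subset B :|: B').
    apply/negP=> /setIidPl/(congr1 (fun C : {set 'I_n} => #|C|)).
    rewrite setIUr cardsU card_initial 1?ltnW // ![initial m :&: _]setIC cB'.
    by have := nohit _ mn; rewrite cB; lia.
  case/subsetPn=> z zm; rewrite inE negb_or => /andP[zB zB'].
  have zy : z < y by move: zm; rewrite inE.
  have zpre : z \in initial m.+1 by move: zm; rewrite !inE; apply: ltnW.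
  have ypre : y \in initial m.+1 by rewrite inE /=.
  exists (swap z y B'); split.
  - by apply: shF; rewrite ?eqy.
  - apply/setP=> w; rewrite !inE; case: tpermP => [->|->|/eqP wz /eqP wy].
    + by rewrite (negbTE zB) !andbF.
    + by rewrite (negbTE zB').
    apply/negP=> /andP[/andP[wB' wB] wm]; move/setP/(_ w): disj.
    by rewrite !inE wB' wB /= ltn_neqAle -ltnS wm andbT (_ : (_ == _) = (w == y)) // wy.
  - rewrite -[in LHS](@swap_id _ z y (initial m.+1)) ?zpre ?ypre // -swapI card_swap.
    by rewrite cap eqy yB cardsU1 yC cB' cB.
  - move=> w wm; rewrite inE tpermD ?eqB // 1?ltnW //; apply: contraTneq wm => <-.
      by rewrite -ltnNge; move: zpre; rewrite inE.
    by rewrite /= ltnn.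
have [B' [FB' disj _ _]] := inv n (leqnn n); have := iF FB' BF; rewrite -(setIT (_ :&: _)).
rewrite (_ : setT = initial n) ?disj ?eqxx //.
by apply/setP=> y; rewrite !inE ltn_ord.
Qed.

Lemma initial_growth m m' B : m <= m' -> m' <= n ->
  m + #|B :&: initial m'| <= m' + #|B :&: initial m|.
Proof.
move=> mm' m'n; have mn := leq_trans mm' m'n.
have sub : initial m :\: B \subset initial m' :\: B.
  by apply: setSD; apply/subsetP=> y; rewrite !inE => /leq_trans->.
have := subset_leq_card sub; have := cardsID B (initial m); have := cardsID B (initial m').
by rewrite !card_initial // ![B :&: _]setIC; lia.
Qed.

(** A member with this trace reaches a majority only at some [m' > m]; comparing its growth up to
    [m'] with its size [k] gives the second bound, by which a [k]-set with trace [initial m :\: S]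
    has an element left to place. *)
Lemma trace_unhit m S : (forall m', m' <= m -> 2 * #|S :&: initial m'| <= m') ->
  S \subset initial m -> 0 < #|trace F (initial m) S| -> (m < n) && (m < k + #|S|).
Proof.
move=> unhit Sm /card_gt0P[B /traceP[BF BS]]; have [m' m'n hm'] := shifted_majority BF.
have mm' : m < m'.
  rewrite ltnNge; apply/negP=> m'm; have := unhit _ m'm.
  have sub : initial m' \subset initial m by apply/subsetP=> y; rewrite !inE => /leq_trans->.
  by rewrite -BS -setIA (setIidPr sub) leqNgt hm'.
rewrite (leq_trans mm') //=.
have := initial_growth B (ltnW mm') m'n; rewrite BS.
have := subset_leq_card (subsetIl B (initial m')); rewrite (uF BF).
move: hm'; set c := #|_ :&: initial m'|; set s := #|S|; lia.
Qed.

(* After [i.+2] elements of [S] and [i.+1] elements outside it, local LYM gives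
   the ratio [(N - p + 1) / p] of the tails, least for [i = 0]. *)
Lemma hit_ratio i p N : p + i.+1 = k -> N + i.+1.*2.+1 = n ->
  (n - k - 1) * p <= (k - 1) * (N - p.-1).
Proof.
move=> pk Nn; have -> : n - k - 1 = (k - 1) + (n - 2 * k) by lia.
case: p pk => [|p] pk; first by rewrite muln0.
have -> : N - p.+1.-1 = p + (n - 2 * k) + 1 by lia.
have -> : k - 1 = p + i.+1 by lia.
nia.
Qed.

(* [S] is the initial trace of a set missing 0, and [initial m :\: S] that of a set
   disjoint from it.  Both are extended by the next element until [S] holds a
   majority; then local LYM applies to the tails. *)
Lemma majority_bound m S : m <= n -> 0 < m -> S \subset initial m ->
    (forall y, y \in S -> 0 < y) ->
    (forall m', m' < m -> 2 * #|S :&: initial m'| <= m') -> 2 * #|S| <= m.+1 ->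
  (k - 1) * #|trace F (initial m) (initial m :\: S)| + (n - k - 1) * #|trace F (initial m) S|
    <= (k - 1) * 'C(n - m, k - (m - #|S|)).
Proof.
have [d] := ubnP (n - m); elim: d m S => // d IH m S ltd mn m0 Sm S0 unhit hS.
have cJ := card_initial mn.
have cS' : #|initial m :\: S| = m - #|S| by rewrite cardsD (setIidPr Sm) cJ.
have [f0|f0] := posnP #|trace F (initial m) S|.
  rewrite f0 muln0 addn0 leq_mul2l; apply/orP; right.
  by have := card_trace_le (initial m) (initial m :\: S) uF; rewrite card_ord cJ cS'.
have Sk : #|S| <= k.
  have [B /traceP[BF <-]] := card_gt0P f0.
  by rewrite -(uF BF) subset_leq_card // subsetIl.
have [hm|hit] := leqP (2 * #|S|) m.
  have /andP[lt_mn mk] : (m < n) && (m < k + #|S|).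
    apply: trace_unhit f0 => // m'; rewrite leq_eqVlt => /orP[/eqP->|]; last exact: unhit.
    by rewrite (setIidPl Sm).
  pose y := Ordinal lt_mn; have ym : y \notin initial m := initialS_notin lt_mn.
  have yS : y \notin S by apply: contraNN ym => /(subsetP Sm).
  have ltd' : n - m.+1 < d by lia.
  have SI m' : m' <= m -> (y |: S) :&: initial m' = S :&: initial m'.
    move=> m'm; rewrite setIUl (_ : [set y] :&: initial m' = set0) ?set0U //.
    by apply/eqP; rewrite setI_eq0 disjoints1 inE -leqNgt.
  have unhitS m' : m' < m.+1 -> 2 * #|S :&: initial m'| <= m'.
    rewrite ltnS leq_eqVlt => /orP[/eqP->|]; last exact: unhit.
    by rewrite (setIidPl Sm).
  have Sm1 : S \subset initial m.+1 by rewrite initialS -/y subsetU // Sm orbT.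
  have ySm1 : y |: S \subset initial m.+1 by rewrite initialS -/y setUS.
  have h2 := IH m.+1 S ltd' lt_mn isT Sm1 S0 unhitS (leqW (leqW hm)).
  have cyS : #|y |: S| = #|S|.+1 by rewrite cardsU1 yS.
  have h1 : (k - 1) * #|trace F (initial m.+1) (initial m.+1 :\: (y |: S))|
      + (n - k - 1) * #|trace F (initial m.+1) (y |: S)|
      <= (k - 1) * 'C(n - m.+1, k - (m.+1 - #|S|.+1)).
    rewrite -cyS; apply: IH => //.
    - by move=> w; rewrite inE => /orP[/set1P->|/S0].
    - by move=> m' m'm; rewrite SI //; apply: unhitS.
    - by rewrite cyS; lia.
  have nyD : y \notin initial m :\: S by rewrite inE (negbTE ym) andbF.
  (* The two traces are split by the next point [y] and paired so that they stay complementary: [S]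
     with [y] added to its complement, and [y |: S] with the old complement. Pascal's rule adds the
     two bounds. *)
  rewrite (card_trace1 F Sm ym) (card_trace1 F (subsetDl _ S) ym) -initialS.
  have e1 : initial m.+1 :\: S = y |: (initial m :\: S).
    rewrite initialS -/y setDUl; congr (_ :|: _); apply/setDidPl.
    by rewrite disjoints1.
  have e2 : initial m.+1 :\: (y |: S) = initial m :\: S.
    apply/setP=> w; rewrite initialS -/y !in_setD !in_setU1 negb_or.
    by have [->|] := eqVneq w y; rewrite ?(negbTE ym) ?andbF.
  rewrite e1 in h2; rewrite e2 in h1.
  have -> : n - m = (n - m.+1).+1 by lia.
  have -> : k - (m - #|S|) = (k - (m.+1 - #|S|)).+1 by lia.
  rewrite subSS in h1.
  rewrite (_ : k - (m - #|S|) = (k - (m.+1 - #|S|)).+1) in h1; last lia.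
  by rewrite binS !mulnDr [X in _ + X <= _]addnC addnACA leq_add.
have mS : m.+1 = 2 * #|S| by lia.
(* A majority reached by a single element would give [m = 1] and [S] equal to the singleton of 0,
   which is excluded. *)
have S2 : 1 < #|S|.
  rewrite ltn_neqAle; apply/andP; split; last by case: #|S| mS m0 => //; lia.
  apply/eqP=> S1; have [y defS] : exists y, S = [set y] by apply/cards1P; rewrite -S1.
  have yS : y \in S by rewrite defS set11.
  have := S0 _ yS; have := subsetP Sm _ yS; rewrite inE.
  have -> : m = 1 by move: mS; rewrite -S1; lia.
  by case: (nat_of_ord y).
pose i := #|S| - 2; pose p := k - (m - #|S|); pose N := n - m.
have pp : p + i.+1 = k by rewrite /p /i; lia.
have NN : N + i.+1.*2.+1 = n by rewrite /N /i; lia.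
have h := hit_ratio pp NN.
have DS0 : (initial m :\: S) :&: S = set0.
  by apply/setP=> y; rewrite !inE; case: (y \in S); rewrite ?andbF.
have Crp : 'C(N, N - p.-1) = 'C(N, k - #|S|).
  by rewrite bin_sub; [congr 'C(_, _)|]; rewrite /p /N; lia.
have fS : #|trace F (initial m) S| <= 'C(N, N - p.-1).
  by have := card_trace_le (initial m) S uF; rewrite card_ord cJ Crp.
(* Kruskal-Katona with [z = N] is local LYM: its size premise [fS] is the trivial bound. *)
have cross : #|trace F (initial m) (initial m :\: S)| * 'C(N, N - p.-1)
    + #|trace F (initial m) S| * 'C(N, p) <= 'C(N, p) * 'C(N, N - p.-1).
  by apply: (@trace_cross_small _ F _ _ _ k) => //; rewrite ?card_ord ?cJ ?cS' /p /N; lia.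
have Cpos : 0 < 'C(N, N - p.-1) by rewrite bin_gt0 leq_subr.
have p0 : 0 < p by rewrite /p; lia.
have CNp : p * 'C(N, p) = (N - p.-1) * 'C(N, N - p.-1).
  have := mul_bin_left N p.-1; rewrite prednK // => ->.
  by rewrite -[in RHS]bin_sub ?leq_subr // subKn //; rewrite /p /N; lia.
exact: cross_ratio h CNp Cpos p0 cross.
Qed.

End Shifted.

(** * Families far from every star *)

(** The first bound plus [u] times the second, which gives [a] and [b] the same weight. It serves
    with [K = k - 1] and [K + u = n - k - 1]. *)
Lemma two_bounds K u a b c L : K * a + (K + u) * b <= K * c -> a + L <= c ->
  u * L + (K + u) * (a + b) <= (K + u) * c.
Proof.
move=> h1 h2; have := leq_mul (leqnn u) h2; rewrite mulnDr => h3.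
rewrite mulnDr [in X in _ + (X + _)]mulnDl [in X in _ <= X]mulnDl.
by have := leq_add h1 h3; lia.
Qed.

Section LargeDiversity.

Variables (n k : nat).
Hypotheses (k3 : 2 < k) (le2kn : 2 * k <= n).
Implicit Types (F : {set {set 'I_n}}) (A B S : {set 'I_n}) (x y z : 'I_n).

(** This singles out [z = n - 3] in Kruskal-Katona: there ['C(z, k - 1) / 'C(z, n - k - 1)] is
    exactly [(n - k - 1) / (k - 1)]. *)
Lemma bin_n3 : (k - 1) * 'C(n - 3, k - 1) = (n - k - 1) * 'C(n - 3, k - 2).
Proof.
have := mul_bin_left (n - 3) (k - 2); have -> : (k - 2).+1 = k - 1 by lia.
by move=> ->; congr (_ * _); lia.
Qed.

Lemma bin_n3_sub : 'C(n - 3, n - k - 1) = 'C(n - 3, k - 2).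
Proof. by rewrite -bin_sub; [congr 'C(_, _)|]; lia. Qed.

Lemma bin_n4_sub : 'C(n - 4, n - k - 1) = 'C(n - 4, k - 3).
Proof. by rewrite -bin_sub; [congr 'C(_, _)|]; lia. Qed.

Lemma bin_n3_pascal : 'C(n - 3, k - 2) = 'C(n - 4, k - 2) + 'C(n - 4, k - 3).
Proof.
have -> : n - 3 = (n - 4).+1 by lia.
have -> : k - 2 = (k - 3).+1 by lia.
by rewrite binS.
Qed.

Lemma card_star_split F x : #|F| = #|trace F [set x] set0| + #|trace F [set x] [set x]|.
Proof.
have := @card_trace1 _ F x set0 set0 (sub0set _); rewrite inE !setU0 => <- //.
by apply: eq_card => A; rewrite inE setI0 eqxx andbT.
Qed.

Lemma star_small F x : uniform k F -> intersecting F ->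
  #|trace F [set x] set0| <= 'C(n - 3, k - 2) ->
  (k - 1) * #|trace F [set x] [set x]| + (n - k - 1) * #|trace F [set x] set0|
    <= (k - 1) * 'C(n - 1, k - 1).
Proof.
move=> uF iF hb; apply: (cross_ratio (p := k - 1) (q := n - k - 1) _ bin_n3).
- by rewrite mulnC.
- by rewrite bin_gt0; lia.
- by lia.
rewrite -bin_n3_sub in hb *.
by apply: (@trace_cross_small _ F _ _ _ k) => //;
  rewrite ?setI0 ?cards1 ?cards0 ?card_ord //; lia.
Qed.

Lemma star_large F x (z : nat) : uniform k F -> intersecting F -> n - k - 1 <= z ->
  'C(z, n - k - 1) <= #|trace F [set x] set0| ->
  #|trace F [set x] [set x]| + 'C(z, k - 1) <= 'C(n - 1, k - 1).
Proof.
move=> uF iF zr hb.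
by apply: (@trace_cross_large _ F _ _ set0 k (k - 1) (n - k - 1)) => //;
  rewrite ?setI0 ?cards1 ?cards0 ?card_ord //; lia.
Qed.

(* That is, [#|F|] stays below the full star by [1 - (k - 1) / (n - k - 1)]
   times ['C(n - 4, k - 1)]. *)
Definition far_from_star F := (n - 2 * k) * 'C(n - 4, k - 1) + (n - k - 1) * #|F|
  <= (n - k - 1) * 'C(n - 1, k - 1).

(** As ['C(n - 4, k - 3) = 'C(n - 4, n - k - 1)], the lower bound on the sets missing [x] makes at
    least ['C(n - 4, k - 1)] sets through [x] absent. *)
Lemma far_from_star_of F x : uniform k F -> intersecting F ->
  'C(n - 4, k - 3) <= #|trace F [set x] set0| ->
  (k - 1) * #|trace F [set x] [set x]| + (n - k - 1) * #|trace F [set x] set0|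
    <= (k - 1) * 'C(n - 1, k - 1) -> far_from_star F.
Proof.
rewrite -bin_n4_sub /far_from_star (card_star_split F x) => uF iF hb.
have h := star_large uF iF (_ : _ <= n - 4) hb.
have -> : n - k - 1 = k - 1 + (n - 2 * k) by lia.
by rewrite [#|_| + _]addnC => h2; apply: two_bounds h2 (h _); lia.
Qed.

(** Few sets miss both vertices, so many contain exactly one of them. Kruskal-Katona on the other
    [n - 2] points is applied to the two singleton traces, and to the full and the empty trace. *)
Lemma far_from_star_pair F x y : uniform k F -> intersecting F -> x != y ->
  'C(n - 3, k - 2) < #|trace F [set x] set0| -> 'C(n - 3, k - 2) < #|trace F [set y] set0| ->
  #|trace F [set x; y] set0| <= 'C(n - 4, k - 2) -> far_from_star F.
Proof.
move=> uF iF.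
wlog : x y / #|trace F [set x; y] [set y]| <= #|trace F [set x; y] [set x]|.
  have [le|lt] := leqP #|trace F [set x; y] [set y]| #|trace F [set x; y] [set x]|.
    by apply; exact: le.
  move=> wl xy hx hy hr; apply: (wl y x) => //; rewrite 1?eq_sym ?[[set y; x]]setUC //.
  exact: ltnW.
move=> leQP xy hx hy hr.
have cJ : #|[set x; y]| = 2 by rewrite cards2 xy.
have ynx : y \notin [set x] by rewrite inE eq_sym.
have bx := card_trace1 F (sub0set _) ynx; rewrite setU0 setUC in bx.
have fx := card_trace1 F (subxx [set x]) ynx; rewrite !(setUC [set y]) in fx.
have hQ : 'C(n - 4, k - 3) <= #|trace F [set x; y] [set y]|.
  move: hx; rewrite bx bin_n3_pascal => hx; rewrite -(leq_add2l (binomial (n - 4) (k - 2))).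
  by apply: leq_trans (ltnW hx) _; rewrite leq_add2r.
have xy0 : [set x] :&: [set y] = set0.
  by apply/eqP; rewrite setI_eq0 disjoints1 inE.
have yx0 : [set y] :&: [set x] = set0 by rewrite setIC.
have Csplit : 'C(n - 2, k - 1) = 'C(n - 3, k - 1) + 'C(n - 3, k - 2).
  have -> : n - 2 = (n - 3).+1 by lia.
  have -> : k - 1 = (k - 2).+1 by lia.
  by rewrite binS.
(* If the smaller singleton trace exceeded this bound, so would the larger, and the large form of
   Kruskal-Katona would push the smaller one back below it. *)
have leQ : #|trace F [set x; y] [set y]| <= 'C(n - 3, k - 2).
  rewrite leqNgt; apply/negP=> ltQ.
  suff : #|trace F [set x; y] [set y]| + 'C(n - 3, k - 1) <= 'C(n - 2, k - 1) by lia.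
  apply: (@trace_cross_large _ F _ _ [set x] k _ (n - k - 1)) => //;
    rewrite ?cJ ?cards1 ?card_ord ?bin_n3_sub; lia.
have h1 : (k - 1) * #|trace F [set x; y] [set x]| + (n - k - 1) * #|trace F [set x; y] [set y]|
    <= (k - 1) * 'C(n - 2, k - 1).
  apply: (cross_ratio (p := k - 1) (q := n - k - 1) _ bin_n3).
  - by rewrite mulnC.
  - by rewrite bin_gt0; lia.
  - by lia.
  rewrite -bin_n3_sub in leQ *.
  by apply: (@trace_cross_small _ F _ _ _ k) => //; rewrite ?cJ ?cards1 ?card_ord //; lia.
have h2 : #|trace F [set x; y] [set x]| + 'C(n - 4, k - 1) <= 'C(n - 2, k - 1).
  apply: (@trace_cross_large _ F _ _ [set y] k _ (n - k - 1)) => //;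
    by rewrite ?cJ ?cards1 ?card_ord ?bin_n4_sub //; lia.
(* At [z = n - 4] the two binomials of Kruskal-Katona coincide, so the bound has ratio 1. *)
have h3 : #|trace F [set x; y] [set x; y]| + #|trace F [set x; y] set0| <= 'C(n - 2, k - 2).
  have Cpos : 0 < 'C(n - 4, k - 2) by rewrite bin_gt0; lia.
  have Csub : 'C(n - 4, n - 2 - k) = 'C(n - 4, k - 2).
    by rewrite -bin_sub; [congr 'C(_, _)|]; lia.
  rewrite -(leq_pmul2r Cpos) mulnDl -{1 3}Csub.
  apply: (@trace_cross_small _ F _ _ _ k) => //; rewrite ?Csub ?setI0 ?cJ ?cards0 ?card_ord //; lia.
rewrite /far_from_star (card_star_split F x) bx fx.
have -> : 'C(n - 1, k - 1) = 'C(n - 2, k - 1) + 'C(n - 2, k - 2).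
  have -> : n - 1 = (n - 2).+1 by lia.
  have -> : k - 1 = (k - 2).+1 by lia.
  by rewrite binS.
have e : n - k - 1 = k - 1 + (n - 2 * k) by lia.
rewrite e in h1 *; have h4 := two_bounds h1 h2.
move: h3 h4; rewrite {e h1}; move: (k - 1 + _) (_ * 'C(n - 4, _)) => w l.
move: #|_| #|_| #|_| #|_| => r q p s h3 h4.
have := leq_mul (leqnn w) h3; rewrite !mulnDr in h4 *; lia.
Qed.

(** The weight drops under every effective compression to the left and so serves as termination
    measure. *)
Definition wt B : nat := \sum_(x in B) x.
Definition weight F : nat := \sum_(B in F) wt B.

Lemma wt_swap z y B : z < y -> y \in B -> z \notin B -> wt (swap z y B) < wt B.
Proof.
move=> zy yB zB; rewrite /wt (reindex_inj (@perm_inj _ (tperm z y))) /=.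
under eq_bigl do rewrite inE tpermK.
rewrite (bigD1 y) //= [X in _ < X](bigD1 y) //= tpermR -addSn leq_add // leq_sum //.
move=> x /andP[xB xy]; rewrite tpermD //; last by rewrite eq_sym.
by apply: contraNneq zB => ->.
Qed.

Lemma weight_shift z y B F : z < y -> B \in F -> y \in B -> z \notin B ->
  swap z y B \notin F -> weight (shift z y F) < weight F.
Proof.
move=> zy BF yB zB sBF.
pose e (G : {set {set 'I_n}}) A := (A \in G) * wt A + (swap z y A \in G) * wt (swap z y A).
have dbl G : \sum_(A : {set 'I_n}) e G A = weight G + weight G.
  rewrite big_split /= [X in _ + X](reindex_inj (inv_inj (@swapK _ z y))) /=.
  under [X in _ + X]eq_bigr do rewrite swapK.
  rewrite /weight [in RHS]big_mkcond /=.
  by congr (_ + _); apply: eq_bigr => A _; case: (A \in G); rewrite /= ?mul1n.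
have lt_dbl a b : a + a < b + b -> a < b by lia.
apply: lt_dbl; rewrite -!dbl [X in X < _](bigD1 B) //= [X in _ < X](bigD1 B) //= -addSn.
apply: leq_add.
  rewrite /e ![_ \in shift _ _ _]inE swapK mem_swapL mem_swapR yB zB BF (negbTE sBF) /=.
  by rewrite (negbTE zB) /= mul0n !mul1n addn0; apply: wt_swap.
apply: leq_sum => A _; rewrite /e ![_ \in shift _ _ _]inE swapK mem_swapL mem_swapR.
have [zA|zA] := boolP (z \in A); have [yA|yA] := boolP (y \in A) => //=.
  have := @wt_swap z y (swap z y A) zy; rewrite mem_swapL mem_swapR swapK zA yA.
  by move=> /(_ isT isT)/ltnW; do 2!case: (_ \in F); rewrite //= ?mul1n ?mul0n ?addn0.
have := @wt_swap z y A zy yA zA.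
by move=> /ltnW; do 2!case: (_ \in F); rewrite //= ?mul1n ?mul0n ?addn0 ?add0n.
Qed.

(** Sets missing [y] stay in place, and for any other [x] the swap does not affect membership of
    [x]. So only at [z] can the number of missing sets collapse. *)
Lemma card_avoid_shift z y x F : x != z ->
  #|trace F [set x] set0| <= #|trace (shift z y F) [set x] set0|.
Proof.
move=> xz; have [<-|xy] := eqVneq x y.
  apply/subset_leq_card/subsetP=> A; rewrite !mem_trace0 inE => /andP[-> /negbTE->].
  by rewrite /= andbT if_same.
rewrite -(card_shift z y (trace F _ _)); apply/subset_leq_card/subsetP=> A sA; rewrite mem_trace0.
have sub : shift z y (trace F [set x] set0) \subset shift z y F.
  apply/subsetP=> C; rewrite !inE; case: ifP => _.
    by case/andP=> /andP[-> _] /andP[-> _].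
  by case: ifP => _; [case/orP=> /andP[-> _]; rewrite ?orbT | case/andP].
rewrite (subsetP sub) //=; case: (mem_shift sA); rewrite mem_trace0 => /andP[_] //.
by rewrite inE tpermD 1?eq_sym.
Qed.

(** Sets missing both points are fixed by the swap. Hence a collapse at [z] shows that few sets of
    [F] miss both [z] and [y]. *)
Lemma card_avoid2_shift z y F :
  #|trace F [set z; y] set0| <= #|trace (shift z y F) [set z] set0|.
Proof.
apply/subset_leq_card/subsetP=> A; rewrite !inE => /andP[AF].
rewrite setIUr setU_eq0 => /andP[-> /eqP Ay]; rewrite andbT.
have /negbTE-> : y \notin A by apply/negP=> yA; move/setP/(_ y): Ay; rewrite !inE yA eqxx.
by rewrite AF /= if_same.
Qed.

Theorem diversity_bound F : uniform k F -> intersecting F ->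
  (forall x, 'C(n - 3, k - 2) < #|trace F [set x] set0|) -> far_from_star F.
Proof.
have [m] := ubnP (weight F); elim: m F => // m IH F ltm uF iF big.
have leC : 'C(n - 4, k - 3) <= 'C(n - 3, k - 2) by rewrite bin_n3_pascal leq_addl.
have n0 : 0 < n by lia.
have [/exists_inP[B BF] |] := boolP [exists B in F, [exists y in B, [exists z : 'I_n,
    [&& z < y, z \notin B & swap z y B \notin F]]]]; last first.
  move=> sh; pose x0 := Ordinal n0.
  have shF (z y : 'I_n) (B : {set 'I_n}) :
      z < y -> B \in F -> y \in B -> z \notin B -> swap z y B \in F.
    move=> zy BF yB zB; apply: contraNT sh => sB.
    apply/exists_inP; exists B => //; apply/exists_inP; exists y => //.
    by apply/existsP; exists z; rewrite zy zB.
  (* The family is shifted; [majority_bound] is started at [m = 1] with empty [S], that is, with the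
     sets missing the first vertex. *)
  apply: (@far_from_star_of F x0) => //; first by apply: leq_trans (ltnW (big _)).
  have := @majority_bound n k F uF iF le2kn shF 1 set0 n0 isT (sub0set _).
  have -> : initial n 1 = [set x0] by apply/setP=> y; rewrite !inE ltnS leqn0.
  rewrite setD0 cards0 subn0; apply=> // [y|m' _]; first by rewrite inE.
  by rewrite set0I cards0.
case/exists_inP=> y yB /existsP[z /and3P[zy zB sB]].
have zny : z != y by apply: contraTneq zy => ->; rewrite ltnn.
pose G := shift z y F.
have uG : uniform k G by apply: uniform_shift.
have iG : intersecting G by apply: shift_cross.
have far_G : far_from_star G -> far_from_star F by rewrite /far_from_star card_shift.
have [small|bigz] := leqP #|trace G [set z] set0| 'C(n - 3, k - 2).
  (* After a deep collapse the pair argument applies to [F]. Between the two thresholds [star_small]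
     applies to [G], and [far_from_star] depends only on the size, which compression preserves. *)
  have [vsmall|mid] := leqP #|trace G [set z] set0| 'C(n - 4, k - 2).
    by apply: (@far_from_star_pair F z y) => //; apply: leq_trans (card_avoid2_shift _ _ _) _.
  apply/far_G/(@far_from_star_of G z) => //; last exact: star_small.
  apply: leq_trans (ltnW mid).
  have := mul_bin_left (n - 4) (k - 3); have -> : (k - 3).+1 = k - 2 by lia.
  move=> e; rewrite -(@leq_pmul2l (k - 2)); last by lia.
  by rewrite e leq_mul2r; apply/orP; right; lia.
apply/far_G/IH => //; first by apply: leq_trans (weight_shift zy BF yB zB sB) _.
move=> x; have [->//|xz] := eqVneq x z.
by apply: leq_trans (big x) (card_avoid_shift _ _ xz).
Qed.

End LargeDiversity.

(** * Degrees *)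

Lemma card_between (T : finType) k (U W : {set T}) : U :&: W = set0 -> #|U| <= k ->
  #|[set A : {set T} | [&& #|A| == k, U \subset A & A :&: W == set0]]|
    = 'C(#|T| - #|U| - #|W|, k - #|U|).
Proof.
move=> UW Uk; have -> : #|T| - #|U| - #|W| = #|~: (U :|: W)|.
  by rewrite -subnDA -[#|U| + _]cardsUI UW cards0 addn0 -(cardsC (U :|: W)) addKn.
rewrite -cards_draws.
have inj : {in [set D : {set T} | D \subset ~: (U :|: W) & #|D| == k - #|U|] &,
    injective (fun D => U :|: D)}.
  have h D : D \in [set D : {set T} | D \subset ~: (U :|: W) & #|D| == k - #|U|] ->
      (U :|: D) :\: U = D.
    rewrite inE => /andP[DUW _]; rewrite setDUl setDv set0U; apply/setDidPl.
    by rewrite disjoints_subset (subset_trans DUW) // setCS subsetUl.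
  by move=> D E /h {2}<- /h {2}<- ->.
rewrite -(card_in_imset inj); apply: eq_card => A; rewrite inE.
apply/and3P/imsetP => [[/eqP cA UA /eqP AW]|[D]].
  exists (A :\: U); last by rewrite -{1}(setID A U) (setIidPr UA).
  rewrite inE cardsD (setIidPr UA) cA eqxx andbT setCU.
  rewrite subsetI {1}setDE subsetIr /= (subset_trans (subsetDl _ _)) //.
  by rewrite -disjoints_subset -setI_eq0 AW.
rewrite inE setCU subsetI => /andP[/andP[DU DW] /eqP cD] ->.
rewrite subsetUl setIUl UW set0U setI_eq0 disjoints_subset DW; split=> //.
by rewrite cardsU cD setIC (_ : D :&: U = set0) ?cards0 ?subn0 ?subnKC //;
   apply/eqP; rewrite setI_eq0 disjoints_subset.
Qed.

Lemma card_sum_pred (T : finType) (X : {set T}) (P : pred T) :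
  #|[set A in X | P A]| = \sum_(A in X) (if P A then 1 else 0).
Proof. by rewrite -big_mkcondr -sum1_card; apply: eq_bigl => A; rewrite inE. Qed.

Lemma add_sub_le a c d : a + c <= d -> a <= d - c.
Proof. lia. Qed.

Lemma add_sub_le2 a1 a2 b c1 c2 d :
  a1 + (c1 + c2) <= d -> a2 <= b - 2 -> b <= c2 + 2 -> a1 + a2 <= d - c1.
Proof. lia. Qed.

Section Degrees.

Variables (n k t : nat) (F : {set {set 'I_n}}).
Implicit Types (A B G S : {set 'I_n}) (x y : 'I_n).
Hypotheses (uF : uniform k F) (iF : intersecting F) (t0 : 0 < t).

Lemma degree_split S x :
  degree F S = #|[set A in F | (x \in A) && (S \subset A)]|
             + #|[set A in trace F [set x] set0 | S \subset A]|.
Proof.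
rewrite /degree -(cardsID [set A : {set 'I_n} | x \in A]); congr (_ + _).
  by apply: eq_card => A; rewrite !inE -andbA [_ && (x \in A)]andbC.
apply: eq_card => A; rewrite in_setD !in_set -!andbA.
by rewrite setI_eq0 disjoint_sym disjoints1 andbC -andbA [(S \subset A) && _]andbC.
Qed.

Lemma card_through_le S x (X : {set {set 'I_n}}) : #|S| = t -> x \notin S -> t < k ->
  (forall A, A \in X -> [/\ #|A| = k, x |: S \subset A & A \notin F]) ->
  #|[set A in F | (x \in A) && (S \subset A)]| + #|X| <= 'C(n - t - 1, k - t - 1).
Proof.
move=> cS xS tk hX; have cxS : #|x |: S| = t.+1 by rewrite cardsU1 xS cS.
have := @card_between _ k (x |: S) set0 (setI0 _); rewrite cxS => /(_ tk).
rewrite cards0 subn0 card_ord -subnDA addn1 => e; rewrite -subnDA addn1 -e.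
rewrite -cardsUI [X in _ + X](_ : _ = 0) ?addn0.
  apply/subset_leq_card/subUsetP; split; apply/subsetP=> A.
    rewrite !inE => /and3P[AF xA SA].
    by rewrite (uF AF) setI0 !eqxx andbT /= subUset sub1set xA.
  by move=> /hX[cA SA _]; rewrite inE cA setI0 !eqxx SA.
apply/eqP; rewrite cards_eq0; apply/eqP/setP=> A; rewrite in_setI in_set0.
by apply/negP=> /andP[+ /hX[_ _ /negP nAF]]; rewrite inE => /andP[/nAF].
Qed.

Lemma disjoint_notin G A : G \in F -> A :&: G = set0 -> A \notin F.
Proof. by move=> GF AG; apply/negP=> /iF/(_ GF); rewrite AG eqxx. Qed.

Lemma card_disjoint_from S G x : #|S| = t -> x \notin S -> x \notin G -> #|G| = k ->
  S :&: G = set0 -> t < k ->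
  #|[set A : {set 'I_n} | [&& #|A| == k, x |: S \subset A & A :&: G == set0]]|
    = 'C(n - t - k - 1, k - t - 1).
Proof.
move=> cS xS xG cG SG tk; rewrite card_between ?cardsU1 ?xS ?cS ?card_ord ?cG //.
  by congr 'C(_, _); lia.
by rewrite setIUl SG setU0; apply/eqP; rewrite setI_eq0 disjoints1.
Qed.

Lemma exists_outside x G H : t + 2 * k <= n -> G \in F -> H \in F ->
  exists S, [/\ #|S| = t, x \notin S, S :&: G = set0 & S :&: H = set0].
Proof.
move=> tn GF HF; pose W := x |: (G :|: H).
have cW : #|W| <= 2 * k.
  have := cardsUI G H; rewrite (uF GF) (uF HF) => e.
  have GH : 0 < #|G :&: H| by rewrite card_gt0 iF.
  by rewrite cardsU1; move: e GH; case: (x \notin _); move: #|_ :|: _| #|_ :&: _|; lia.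
have : 0 < #|[set S : {set 'I_n} | S \subset ~: W & #|S| == t]|.
  rewrite cards_draws bin_gt0; have := cardsC W; rewrite card_ord.
  move: cW; move: #|W| #|~: W|; lia.
case/card_gt0P=> S; rewrite inE => /andP[SW /eqP cS].
have out y : y \in S -> [&& y != x, y \notin G & y \notin H].
  by move=> /(subsetP SW); rewrite !inE !negb_or.
exists S; split=> //.
- by apply/negP=> /out; rewrite eqxx.
- by apply/setP=> y; rewrite !inE; apply/negP=> /andP[/out/and3P[_ /negP]].
- by apply/setP=> y; rewrite !inE; apply/negP=> /andP[/out/and3P[_ _ /negP]].
Qed.

(** The threshold is [#|X2| + 2]: besides [G] and [H], which do not contain [S], at most [#|X2|]
    sets missing [x] can add to the degree of [S]. *)
Lemma degree_small_diversity x : t + 2 * k <= n -> t.+1 < k ->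
  0 < #|trace F [set x] set0| -> #|trace F [set x] set0| <= 'C(n - k - t - 2, k - t - 2) + 2 ->
  exists2 S : {set 'I_n}, #|S| = t &
    degree F S <= 'C(n - t - 1, k - t - 1) - 'C(n - t - k - 1, k - t - 1).
Proof.
move=> tn tk /card_gt0P[G aG] leb; move: (aG); rewrite mem_trace0 => /andP[GF xG].
have nsub S A : #|S| = t -> S :&: A = set0 -> ~~ (S \subset A).
  by move=> cS SA; apply/negP=> /setIidPl; rewrite SA => S0; move: t0; rewrite -cS -S0 cards0.
have [/subsetP one|/subsetPn[H aH]] := boolP (trace F [set x] set0 \subset [set G]).
  have [S [cS xS SG _]] := exists_outside x tn GF GF; exists S => //.
  pose X := [set A : {set 'I_n} | [&& #|A| == k, x |: S \subset A & A :&: G == set0]].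
  have := card_disjoint_from cS xS xG (uF GF) SG (ltnW tk); rewrite -/X => cX.
  have : #|[set A in F | (x \in A) && (S \subset A)]| + #|X| <= 'C(n - t - 1, k - t - 1).
    apply: card_through_le => // [|A]; first exact: ltnW.
    rewrite inE => /and3P[/eqP-> sA /eqP disj]; split=> //.
    exact: disjoint_notin disj.
  rewrite cX => hle; rewrite (degree_split S x) [X in _ + X](_ : _ = 0) ?addn0.
    exact: add_sub_le.
  apply/eqP; rewrite cards_eq0; apply/eqP/setP=> A; rewrite inE in_set0.
  by apply/negP=> /andP[/one/set1P->]; apply/negP/nsub.
move=> HG; move: (aH); rewrite mem_trace0 => /andP[HF xH].
have [S [cS xS SG SH]] := exists_outside x tn GF HF; exists S => //.
(* Members of [X2] contain [g] and thus meet [G], which keeps [X2] disjoint from [X1]. *)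
have /subsetPn[g gG gH] : ~~ (G \subset H).
  by apply: contraNN HG => GH; rewrite inE eq_sym eqEcard GH (uF GF) (uF HF) leqnn.
have gS : g \notin S by apply/negP=> gS; move/setP/(_ g): SG; rewrite !inE gS gG.
have gx : g != x by apply: contraNneq xG => <-.
pose X1 := [set A : {set 'I_n} | [&& #|A| == k, x |: S \subset A & A :&: G == set0]].
pose X2 := [set A : {set 'I_n} | [&& #|A| == k, g |: (x |: S) \subset A & A :&: H == set0]].
have cX1 : #|X1| = 'C(n - t - k - 1, k - t - 1).
  exact: card_disjoint_from cS xS xG (uF GF) SG (ltnW tk).
have cX2 : #|X2| = 'C(n - k - t - 2, k - t - 2).
  rewrite card_between ?cardsU1 ?in_setU1 ?negb_or ?gx ?gS ?xS ?cS ?card_ord ?(uF HF) //.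
    by congr 'C(_, _); clear; lia.
  rewrite !setIUl SH setU0; apply/eqP; rewrite setU_eq0 !setI_eq0 !disjoints1.
  by rewrite gH xH.
have cX : #|X1 :|: X2| = #|X1| + #|X2|.
  rewrite -[RHS]cardsUI [X in _ = _ + X](_ : _ = 0) ?addn0 //.
  apply/eqP; rewrite cards_eq0; apply/eqP/setP=> A; rewrite !inE.
  apply/negP=> /andP[/and3P[_ _ /eqP/setP/(_ g)]]; rewrite !inE gG andbT => gA.
  by rewrite subUset sub1set gA andbF.
have : #|[set A in F | (x \in A) && (S \subset A)]| + #|X1 :|: X2| <= 'C(n - t - 1, k - t - 1).
  apply: card_through_le => // [|A]; first exact: ltnW.
  rewrite !inE => /orP[]/and3P[/eqP-> sA /eqP disj]; split=> //.
  - exact: disjoint_notin disj.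
  - by apply: subset_trans sA; apply: subsetUr.
  - exact: disjoint_notin disj.
rewrite cX cX1 cX2 (degree_split S x).
have : #|[set A in trace F [set x] set0 | S \subset A]| <= #|trace F [set x] set0| - 2.
  have -> : 2 = #|[set G; H]| by rewrite cards2 eq_sym; move: HG; rewrite inE => ->.
  have sub : [set G; H] \subset trace F [set x] set0.
    by apply/subsetP=> A; rewrite in_set2 => /orP[]/eqP->.
  rewrite -(setIidPr sub) -cardsD; apply/subset_leq_card/subsetP=> A.
  rewrite in_setD in_set in_set2 => /andP[-> SA]; rewrite andbT.
  by apply/negP=> /orP[]/eqP defA; move: SA; rewrite defA; apply/negP/nsub.
move=> h2 h1; exact: add_sub_le2 h1 h2 leb.
Qed.

Lemma sum_degrees x :
  \sum_(S : {set 'I_n} | (S \subset [set~ x]) && (#|S| == t)) degree F S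
    = #|trace F [set x] [set x]| * 'C(k - 1, t) + #|trace F [set x] set0| * 'C(k, t).
Proof.
have -> : \sum_(S : {set 'I_n} | (S \subset [set~ x]) && (#|S| == t)) degree F S
    = \sum_(A in F) 'C(#|A :\ x|, t).
  have e S : degree F S = \sum_(A in F) (if S \subset A then 1 else 0).
    exact: card_sum_pred F (fun A => S \subset A).
  rewrite (eq_bigr _ (fun S _ => e S)).
  rewrite exchange_big; apply: eq_bigr => A AF; rewrite -cards_draws.
  rewrite -big_mkcondr -sum1_card; apply: eq_bigl => S.
  by rewrite inE setDE subsetI; case: (S \subset A); rewrite ?andbT ?andbF.
rewrite (bigID (fun A : {set 'I_n} => x \in A)) /=; congr (_ + _).
  rewrite (eq_bigl (fun A => A \in trace F [set x] [set x])); last first.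
    move=> A; rewrite inE; congr (_ && _); apply/idP/eqP => [xA|/setP/(_ x)].
      by apply/setIidPr; rewrite sub1set.
    by rewrite !inE eqxx andbT.
  rewrite -sum_nat_const; apply: eq_bigr => A /traceP[AF Ax]; congr 'C(_, _).
  have xA : x \in A by have := set11 x; rewrite -Ax inE => /andP[].
  by have := cardsD1 x A; rewrite xA (uF AF) => ->; rewrite addKn.
rewrite (eq_bigl (fun A => A \in trace F [set x] set0)); last by move=> A; rewrite mem_trace0.
rewrite -sum_nat_const; apply: eq_bigr => A; rewrite mem_trace0 => /andP[AF xA].
by congr 'C(_, _); have := cardsD1 x A; rewrite (negbTE xA) (uF AF).
Qed.

Lemma min_degree_sum x : min_degree t F * 'C(n - 1, t)
  <= #|trace F [set x] [set x]| * 'C(k - 1, t) + #|trace F [set x] set0| * 'C(k, t).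
Proof.
rewrite -sum_degrees.
have -> : n - 1 = #|[set~ x]| by rewrite cardsC1 card_ord subn1.
rewrite -cards_draws mulnC -sum_nat_const (eq_bigl _ _ (in_set _)) leq_sum //.
by move=> S /andP[_ /eqP cS]; apply: min_degree_le.
Qed.

(** The minimum is at most the average over all vertices, and each set misses [n - k] of them. *)
Lemma diversity_average x : (forall y, #|trace F [set x] set0| <= #|trace F [set y] set0|) ->
  n * #|trace F [set x] set0| <= (n - k) * #|F|.
Proof.
move=> min_x; have : \sum_(y : 'I_n) #|trace F [set x] set0| <= \sum_(y : 'I_n) #|trace F [set y] set0|.
  by apply: leq_sum.
rewrite sum_nat_const card_ord => /leq_trans; apply.
have e (y : 'I_n) : #|trace F [set y] set0| = \sum_(A in F) (if y \notin A then 1 else 0).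
  rewrite -(card_sum_pred F (fun A => y \notin A)).
  by apply: eq_card => A; rewrite mem_trace0 inE.
under eq_bigr do rewrite e.
rewrite exchange_big /=.
rewrite [X in _ <= X]mulnC -sum_nat_const leq_sum // => A AF.
rewrite -(uF AF) -[n in n - _]card_ord -[#|'I_n|](cardsC A) addKn -sum1_card.
by rewrite -big_mkcond leq_eqVlt; apply/orP; left; apply/eqP/eq_bigl => y; rewrite inE.
Qed.

End Degrees.

(** * Binomial estimates *)

Lemma bin_ratio a b c d r : (forall i, i < r -> (a - i) * d <= (b - i) * c) ->
  'C(a, r) * d ^ r <= 'C(b, r) * c ^ r.
Proof.
elim: r => [|r IH] h; first by rewrite !bin0.
rewrite -(@leq_pmul2l r.+1) // !mulnA !mul_bin_left !expnS.
have -> : (a - r) * 'C(a, r) * (d * d ^ r) = (a - r) * d * ('C(a, r) * d ^ r) by ring.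
have -> : (b - r) * 'C(b, r) * (c * c ^ r) = (b - r) * c * ('C(b, r) * c ^ r) by ring.
by rewrite leq_mul ?h // IH // => i ir; rewrite h // ltnW.
Qed.

(** Raising the upper index by one, to [N + i.+1], multiplies the binomial by
    [(N + i.+1) / (N + i.+1 - r)]. *)
Lemma bin_ratio_up N r m c d : r <= N ->
  (forall i, i < m -> c * (N + i.+1 - r) <= d * (N + i.+1)) ->
  'C(N, r) * c ^ m <= 'C(N + m, r) * d ^ m.
Proof.
move=> rN; elim: m => [|m IH] h; first by rewrite addn0.
rewrite !expnSr !mulnA; apply: leq_trans (leq_mul (IH _) (leqnn c)) _.
  by move=> i im; rewrite h // ltnW.
rewrite mulnAC [X in _ <= X]mulnAC leq_mul2r; apply/orP; right.
have pos : 0 < N + m.+1 - r by lia.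
rewrite -(leq_pmul2l pos) [X in _ <= X]mulnA -mul_bin_down [N + m.+1]addnS /=.
have -> : ((N + m).+1 - r) * ('C(N + m, r) * c) = c * (N + m.+1 - r) * 'C(N + m, r).
  by rewrite addnS; ring.
apply: leq_trans (leq_mul (h m _) (leqnn _)) _ => //.
by rewrite addnS; apply: eq_leq; ring.
Qed.

Lemma bin_trinomial m k t : t <= k -> k <= m ->
  'C(m, k) * 'C(k, t) = 'C(m, t) * 'C(m - t, k - t).
Proof.
move=> tk km; have tm := leq_trans tk km.
have pos : 0 < t`! * (k - t)`! * (m - k)`! by rewrite !muln_gt0 !fact_gt0.
apply/eqP; rewrite -(eqn_pmul2r pos); apply/eqP.
have e1 := bin_fact km; have e2 := bin_fact tk; have e3 := bin_fact tm.
have e4 : 'C(m - t, k - t) * ((k - t)`! * (m - k)`!) = (m - t)`!.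
  by have := @bin_fact (m - t) (k - t); rewrite (_ : m - t - (k - t) = m - k); [apply|]; lia.
transitivity (m`!); first by rewrite -e1 -e2; ring.
by rewrite -e3 -e4; ring.
Qed.

Lemma leq_bin_half m i j : i <= j -> 2 * j <= m.+1 -> 'C(m, i) <= 'C(m, j).
Proof.
move=> /subnK <-; elim: (j - i) => [|d IH] //; rewrite addSn => h.
apply: leq_trans (IH _) _; first lia.
rewrite -(@leq_pmul2l (d + i).+1) // mul_bin_left leq_mul2r; apply/orP; right; lia.
Qed.

Lemma leq_bin_middle m i j : i <= j -> i + j <= m -> 'C(m, i) <= 'C(m, j).
Proof.
move=> ij ijm; have [h|h] := leqP (2 * j) m.+1; first exact: leq_bin_half.
by rewrite -[X in _ <= X]bin_sub; [apply: leq_bin_half|]; lia.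
Qed.

Lemma leq_bin_double m r j : 3 * (r + j) <= m.+1 -> 'C(m, r) * 2 ^ j <= 'C(m, r + j).
Proof.
elim: j => [|j IH] h; first by rewrite muln1 addn0.
rewrite expnSr mulnA; apply: leq_trans (leq_mul (IH _) (leqnn 2)) _; first lia.
rewrite addnS -(@leq_pmul2l (r + j).+1) // mul_bin_left mulnCA [X in _ <= X]mulnC leq_mul2l.
by apply/orP; right; lia.
Qed.

Definition admissible n k t :=
  [/\ t = 1, 2 * k + 5 <= n & 30 <= k] \/
  [/\ 1 < t, 4 * (t + 2) <= k & 2 * k + 14 * t <= n].

(** Beyond the tiny range the sets missing [x] thus number at least ['C(z, n - k - 1)] for
    [z = n - k + 2 * t + 1], and Kruskal-Katona applies with this [z]. *)
Lemma bin_threshold n k t : admissible n k t ->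
  'C(n - k + 2 * t + 1, 2 * t + 2) <= 'C(n - k - t - 2, k - t - 2) + 2.
Proof.
move=> hyp; apply: leq_trans (leq_addr _ _).
pose N := n - k - t - 2; have -> : n - k + 2 * t + 1 = N + 3 * t + 3.
  by rewrite /N; case: hyp => -[*]; lia.
rewrite -/N; case: hyp => -[t1 h1 h2].
  rewrite t1 (_ : 3 * 1 = 3) // (_ : 2 * 1 + 2 = 4) //; have N32 : 32 <= N by rewrite /N; lia.
  apply: leq_trans (@leq_bin_middle N 5 (k - 1 - 2) _ _); rewrite ?/N; try lia.
  rewrite -/N.
  have h : 'C(N + 3 + 3, 4) * 256 <= 'C(N, 4) * 625.
    by apply: (@bin_ratio _ _ 5 4 4) => i; lia.
  have h5 : 5 * 'C(N, 5) = (N - 4) * 'C(N, 4) := mul_bin_left N 4.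
  have h28 : 28 * 'C(N, 4) <= (N - 4) * 'C(N, 4) by rewrite leq_mul2r; apply/orP; right; lia.
  by rewrite -h5 in h28; lia.
have N17 : 17 * t + 6 <= N by rewrite /N; lia.
(* Index [3 * t + 6] is the largest that [4 * (t + 2) <= k] allows. Lowering the upper index costs
   at most [(7 / 5) ^ (2 * t + 2)], which is below [2 ^ (t + 1)], and [t + 4] doublings are
   available. *)
apply: leq_trans (@leq_bin_middle N (3 * t + 6) (k - t - 2) _ _); rewrite ?/N; try lia.
rewrite -/N; have -> : 3 * t + 6 = 2 * t + 2 + (t + 4) by lia.
apply: leq_trans (@leq_bin_double _ _ _ _); last lia.
have /bin_ratio h : forall i, i < 2 * t + 2 -> (N + 3 * t + 3 - i) * 5 <= (N - i) * 7 by move=> i; lia.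
have p5 : 0 < 5 ^ (2 * t + 2) by rewrite expn_gt0.
rewrite -(leq_pmul2r p5); apply: leq_trans h _.
rewrite -mulnA leq_mul2l; apply/orP; right.
have -> : 2 * t + 2 = 2 * (t + 1) by lia.
rewrite !expnM; apply: (@leq_trans (2 ^ (t + 1) * (5 ^ 2) ^ (t + 1))).
  by rewrite -expnMn leq_exp2r //; lia.
by rewrite leq_mul2r leq_exp2l //; apply/orP; right; lia.
Qed.

(** * Averaging when Kruskal-Katona applies to the sets missing the vertex *)

Lemma star_trinomial n k t : t < k -> k <= n - 1 ->
  'C(n - 1, k - 1) * 'C(k - 1, t) = 'C(n - 1, t) * 'C(n - t - 1, k - t - 1).
Proof. by move=> tk kn; rewrite bin_trinomial; [congr (_ * 'C(_, _)); lia|lia|lia]. Qed.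

(** Multiplication by [k - t] replaces ['C(k, t)] by [k * 'C(k - 1, t)], and trinomial revision
    turns the averaged full star into the first binomial of the bound. *)
Lemma average_transfer n k t a b : t < k -> k <= n - 1 ->
  (k - t) * a * 'C(k - 1, t) + k * b * 'C(k - 1, t)
    + (k - t) * ('C(n - 1, t) * 'C(n - t - k - 1, k - t - 1))
    <= (k - t) * 'C(n - 1, k - 1) * 'C(k - 1, t) ->
  a * 'C(k - 1, t) + b * 'C(k, t) <=
    ('C(n - t - 1, k - t - 1) - 'C(n - t - k - 1, k - t - 1)) * 'C(n - 1, t).
Proof.
move=> tk kn h.
have e : k * 'C(k - 1, t) = (k - t) * 'C(k, t) by rewrite subn1 mul_bin_down.
have tri := star_trinomial tk kn.
have pos : 0 < k - t by rewrite subn_gt0.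
rewrite mulnBl -(leq_pmul2l pos) mulnBr leq_subRL.
  have -> : (k - t) * ('C(n - t - 1, k - t - 1) * 'C(n - 1, t))
      = (k - t) * 'C(n - 1, k - 1) * 'C(k - 1, t) by rewrite -mulnA tri [_ * 'C(n - 1, t)]mulnC.
  apply: leq_trans h; rewrite addnC mulnDr.
  have -> : k * b * 'C(k - 1, t) = (k - t) * (b * 'C(k, t)).
    by rewrite mulnAC e; ring.
  by apply: eq_leq; ring.
by rewrite !leq_mul // leq_bin2l //; lia.
Qed.

Lemma ratio_shift p q s : p <= q -> (q + s) * p <= (p + s) * q.
Proof. by move=> pq; rewrite !mulnDl mulnC leq_add2l leq_mul2l pq orbT. Qed.

Lemma square_ratio1 d r p : 0 < r -> d <= p -> d ^ 2 * (p + r.+1) <= (d + r) ^ 2 * p.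
Proof.
move=> r0 dp; have -> : (d + r) ^ 2 * p = d ^ 2 * p + (d * (r + r) * p + r * r * p) by ring.
rewrite mulnDr leq_add2l; apply: leq_trans (leq_addr _ _).
have -> : d ^ 2 * r.+1 = d * r.+1 * d by ring.
by rewrite leq_mul // leq_mul2l; apply/orP; right; lia.
Qed.

Lemma square_ratio2 d r g : d ^ 2 * r.+1 <= (2 * d + r) * g ->
  d ^ 2 * (g + r.+1 * r) <= (d + r) ^ 2 * g.
Proof.
move=> h; have -> : (d + r) ^ 2 * g = d ^ 2 * g + r * ((2 * d + r) * g) by ring.
have -> : d ^ 2 * (g + r.+1 * r) = d ^ 2 * g + r * (d ^ 2 * r.+1) by ring.
by rewrite leq_add2l leq_mul2l h orbT.
Qed.

Lemma gap_t1 u r : 5 <= u -> 29 <= r ->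
  (u + 4) ^ 2 * r.+1 <= (2 * (u + 4) + r) * ((u - 1) * r).
Proof.
move=> u5 r29; rewrite -(subnK u5) -(subnK r29); move: (u - 5) (r - 29) => a c.
have -> : a + 5 - 1 = a + 4 by lia.
nia.
Qed.

Lemma gap_t2 u k t d : 1 < t -> 14 * t <= u -> 4 * t + 8 <= k -> d = u + 2 * t + 2 ->
  d * k <= 2 * (u * (k - t) - t * (k - 1)).
Proof.
move=> t1 ut tk ->; have -> : k - t = (k - (4 * t + 8)) + 3 * t + 8 by lia.
move: (k - (4 * t + 8)) (subnK tk) => c <-; rewrite -(subnK ut); move: (u - 14 * t) => a.
nia.
Qed.

Lemma average_small_diversity n k t a b : admissible n k t ->
  (k - 1) * a + (n - k - 1) * b <= (k - 1) * 'C(n - 1, k - 1) ->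
  a + 'C(n - k + 2 * t + 1, k - 1) <= 'C(n - 1, k - 1) ->
  a * 'C(k - 1, t) + b * 'C(k, t) <=
    ('C(n - t - 1, k - t - 1) - 'C(n - t - k - 1, k - t - 1)) * 'C(n - 1, t).
Proof.
move=> hyp hab haL.
have [t0 t4 k16 un] : [/\ 0 < t, 4 * t + 8 <= k, 16 <= k & 2 * k + 5 * t <= n].
  by case: hyp => -[*]; split; lia.
apply: average_transfer; [lia|lia|].
(* [g / (M * (k - t))] is [1 - c / c'] for the required factor [c = k / (k - t)]
   and the available factor [c' = M / (k - 1)]. *)
pose u := n - 2 * k; pose M := n - k - 1; pose g := u * (k - t) - t * (k - 1).
have tu : t * (k - 1) <= u * (k - t).
  apply: (@leq_trans (5 * t * (k - t))).
    by rewrite [5 * t]mulnC -mulnA leq_mul2l; apply/orP; right; lia.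
  by rewrite leq_mul2r; apply/orP; right; rewrite /u; lia.
have eg : M * (k - t) = g + k * (k - 1).
  have -> : M = u + (k - 1) by rewrite /M /u; lia.
  have -> : k * (k - 1) = (k - 1) * (k - t) + t * (k - 1).
    by rewrite mulnC [t * _]mulnC -mulnDr; congr (_ * _); lia.
  by rewrite /g mulnDl [RHS]addnC -addnA subnKC // addnC.
set W := 'C(k - 1, t); set L := 'C(n - k + 2 * t + 1, k - 1) in haL *.
set C := 'C(n - 1, k - 1) in hab haL *; set X := 'C(n - 1, t) * _.
have main : X * (M * (k - t)) <= W * L * g.
  (* [X] is at most [((n - t) / p) ^ t] times [W * 'C(n - k - 1, k - 1)], and passing to [L] gains
     [(c / d) ^ (2 * t + 2)]. Two factors [c / d] absorb each [(n - t) / p]; the last two absorb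
     [M * (k - t) / g]. *)
  pose p := n - k - t; pose d := u + 2 * t + 2; pose c := d + (k - 1).
  have p0 : 0 < p by rewrite /p; lia.
  have d0 : 0 < d by rewrite /d addnC.
  have hX : X * 'C(n - k - 1, t) = 'C(n - 1, t) * W * 'C(n - k - 1, k - 1).
    have e : 'C(n - k - 1, k - 1) * W = 'C(n - k - 1, t) * 'C(n - t - k - 1, k - t - 1).
      by rewrite /W bin_trinomial; [congr (_ * 'C(_, _)); lia|lia|lia].
    have -> : 'C(n - 1, t) * W * 'C(n - k - 1, k - 1) = 'C(n - 1, t) * ('C(n - k - 1, k - 1) * W) by ring.
    by rewrite e /X; ring.
  have hr : 'C(n - 1, t) * p ^ t <= 'C(n - k - 1, t) * (n - t) ^ t.
    apply: bin_ratio => i it; rewrite (_ : n - 1 - i = n - t + (t - 1 - i)); last lia.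
    rewrite (_ : n - k - 1 - i = p + (t - 1 - i)); last by rewrite /p; lia.
    by apply: ratio_shift; rewrite /p; lia.
  have hXr : X * p ^ t <= W * 'C(n - k - 1, k - 1) * (n - t) ^ t.
    have pos : 0 < 'C(n - k - 1, t) by rewrite bin_gt0; lia.
    rewrite -(leq_pmul2r pos) mulnAC hX.
    have -> : 'C(n - 1, t) * W * 'C(n - k - 1, k - 1) * p ^ t
      = W * 'C(n - k - 1, k - 1) * ('C(n - 1, t) * p ^ t) by ring.
    by rewrite -[X in _ <= X]mulnA [_ ^ t * 'C(_, _)]mulnC leq_mul2l hr orbT.
  have hL : 'C(n - k - 1, k - 1) * c ^ (2 * t + 2) <= L * d ^ (2 * t + 2).
    rewrite /L (_ : n - k + 2 * t + 1 = n - k - 1 + (2 * t + 2)); last lia.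
    apply: bin_ratio_up; first lia.
    move=> i it; have -> : n - k - 1 + i.+1 - (k - 1) = u + i.+1 by rewrite /u; lia.
    have -> : n - k - 1 + i.+1 = u + i.+1 + (k - 1) by rewrite /u; lia.
    by rewrite /c [d * _]mulnC; apply: ratio_shift; rewrite /d; lia.
  have k1 : (k - 1).+1 = k by lia.
  have q1 : d ^ 2 * (n - t) <= c ^ 2 * p.
    have -> : n - t = p + (k - 1).+1 by rewrite /p; lia.
    by apply: square_ratio1; rewrite /d /p /u; lia.
  have q2 : d ^ 2 * (M * (k - t)) <= c ^ 2 * g.
    rewrite eg -[X in X * (k - 1)]k1; apply: square_ratio2; rewrite k1.
    case: hyp => -[ht1 ht2 ht3].
      have -> : d = u + 4 by rewrite /d ht1; lia.
      have -> : g = (u - 1) * (k - 1) by rewrite /g ht1 mulnBl.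
      by rewrite -[X in _ * X <= _]k1; apply: gap_t1; rewrite /u; lia.
    have h : d * k <= 2 * g by apply: gap_t2; rewrite // /u; lia.
    have -> : d ^ 2 * k = d * (d * k) by ring.
    apply: leq_trans (leq_mul (leqnn d) h) _.
    by rewrite mulnCA mulnA leq_mul2r leq_addr orbT.
  have pos : 0 < p ^ t * d ^ (2 * t + 2) by rewrite muln_gt0 !expn_gt0 p0 d0.
  rewrite -(leq_pmul2r pos) expnD expnM.
  have -> : X * (M * (k - t)) * (p ^ t * ((d ^ 2) ^ t * d ^ 2))
    = X * p ^ t * ((d ^ 2) ^ t * (d ^ 2 * (M * (k - t)))) by ring.
  apply: leq_trans (leq_mul hXr (leq_mul (leqnn _) q2)) _.
  have -> : W * 'C(n - k - 1, k - 1) * (n - t) ^ t * ((d ^ 2) ^ t * (c ^ 2 * g))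
    = W * 'C(n - k - 1, k - 1) * (c ^ 2 * g) * (d ^ 2 * (n - t)) ^ t by rewrite expnMn; ring.
  apply: (@leq_trans (W * 'C(n - k - 1, k - 1) * (c ^ 2 * g) * (c ^ 2 * p) ^ t)).
    by rewrite leq_mul2l leq_exp2r ?q1 ?orbT.
  have -> : W * 'C(n - k - 1, k - 1) * (c ^ 2 * g) * (c ^ 2 * p) ^ t
    = W * g * p ^ t * ('C(n - k - 1, k - 1) * c ^ (2 * t + 2)).
    by rewrite expnMn expnD expnM; ring.
  apply: leq_trans (leq_mul (leqnn _) hL) _.
  by rewrite expnD expnM; apply: eq_leq; ring.
have M0 : 0 < M by rewrite /M; lia.
have aC : a <= C by apply: leq_trans (leq_addr _ _) haL.
(* With [l] the deficit [C - a], the part [k * (k - 1)] of [M * (k - t)] pays for [b], and the part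
   [g] pays for [X]. *)
rewrite -(subnK aC) in hab haL *; move: (C - a) hab haL => l hab haL.
have {}hab : M * b <= (k - 1) * l by move: hab; rewrite mulnDr addnC leq_add2r.
have {}haL : L <= l by rewrite addnC leq_add2r in haL.
rewrite mulnDr mulnDl -addnA addnC leq_add2r -(leq_pmul2l M0).
have -> : M * ((k - t) * l * W) = M * (k - t) * l * W by ring.
have h1 : M * ((k - t) * X) <= g * l * W.
  have -> : M * ((k - t) * X) = X * (M * (k - t)) by ring.
  apply: leq_trans main _; have -> : g * l * W = W * l * g by ring.
  by rewrite leq_mul2r leq_mul2l haL !orbT.
have h2 : M * (k * b * W) <= k * (k - 1) * l * W.
  have -> : M * (k * b * W) = k * W * (M * b) by ring.
  have -> : k * (k - 1) * l * W = k * W * ((k - 1) * l) by ring.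
  by rewrite leq_mul2l hab orbT.
by rewrite eg mulnDr !mulnDl addnC leq_add.
Qed.

(** * Real inequalities for averaging at large diversity *)

Import Order.TTheory GRing.Theory Num.Theory.

Section Core.
Local Open Scope ring_scope.
Variable R : realFieldType.
Implicit Types v w x p : R.

Lemma bernoulli v m : 0 <= v -> 1 + m%:R * v <= (1 + v) ^+ m.
Proof.
move=> v0; elim: m => [|m IH]; first by rewrite mul0r addr0 expr0.
rewrite exprS; apply: (@le_trans _ _ ((1 + v) * (1 + m%:R * v))); last first.
  by rewrite ler_pM2l // ltr_wpDr.
rewrite -natr1; have : 0 <= m%:R * (v * v) by rewrite !mulr_ge0 ?ler0n.
nra.
Qed.

Lemma bernoulli_le m c v x : (c <= m)%N -> 0 <= v -> x <= v -> 0 <= x -> 1 + c%:R * x <= (1 + v) ^+ m.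
Proof.
move=> cm v0 xv x0; apply: le_trans (bernoulli m v0).
by rewrite lerD2l ler_pM // ler_nat.
Qed.

(* For [v = k / (n - k)] and [w = t / (k - t)], the proportion
   [slack v w / (1 + v) ^+ 4] is what [far_from_star] leaves between the average
   degree and the full star.  It has to cover the sets missing a given [k]-set,
   a proportion of at most [(1 + v) ^- (k - t - 1)]. *)
Definition slack v w := 1 - v ^+ 2 - w * (4 * v + 3 * v ^+ 2 + v ^+ 3).

(** The constants are [24 = 30 - 5 - 1] and [29 = 30 - 1], from [30 <= k] and [t = 1]. With [v] away
    from 1, Bernoulli's inequality suffices. *)
Lemma slack_t1_small v w m : (24 <= m)%N -> 0 < v -> v <= 4 / 5 -> w <= 1 / 29 ->
  1 <= slack v w * (1 + v) ^+ m.
Proof.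
move=> m24 v0 v1 w1.
have h := bernoulli_le m24 (ltW v0) (lexx v) (ltW v0).
have q0 : 0 <= 4 * v + 3 * v ^+ 2 + v ^+ 3 by rewrite !addr_ge0 ?mulr_ge0 ?exprn_ge0 // ltW.
have s : 1 - v ^+ 2 - 1 / 29 * (4 * v + 3 * v ^+ 2 + v ^+ 3) <= slack v w.
  by rewrite /slack lerD2l lerN2 ler_wpM2r.
have d : 1 <= (1 - v ^+ 2 - 1 / 29 * (4 * v + 3 * v ^+ 2 + v ^+ 3)) * (1 + 24%:R * v).
  have vv : v * v <= 16 / 25 by nra.
  have hA : v + 1 / 29 * (4 + 3 * v + v * v) <= 21 / 20 by lra.
  have hA0 : 0 <= v + 1 / 29 * (4 + 3 * v + v * v) by nra.
  have hB : 1 + 24 * v <= 101 / 5 by lra.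
  have hAB : (v + 1 / 29 * (4 + 3 * v + v * v)) * (1 + 24 * v) <= 24.
    by apply: le_trans (ler_pM hA0 _ hA hB) _; lra.
  have : 0 <= v * (24 - (v + 1 / 29 * (4 + 3 * v + v * v)) * (1 + 24 * v)).
    by rewrite mulr_ge0 ?subr_ge0 // ltW.
  by rewrite !exprS expr0 !mulr1; lra.
have s0 : 0 <= 1 - v ^+ 2 - 1 / 29 * (4 * v + 3 * v ^+ 2 + v ^+ 3).
  by rewrite !exprS expr0 !mulr1; nra.
apply: le_trans d _; apply: ler_pM => //.
by rewrite addr_ge0 // mulr_ge0 // ltW.
Qed.

(** From [4 * t + 8 <= k] and [2 <= t] come [k - 5 - t >= 9] and [t / (k - t) <= 1 / 3]. *)
Lemma slack_t2_small v w m : (9 <= m)%N -> 0 < v -> v <= 1 / 3 -> w <= 1 / 3 ->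
  1 <= slack v w * (1 + v) ^+ m.
Proof.
move=> m9 v0 v1 w1.
have h := bernoulli_le m9 (ltW v0) (lexx v) (ltW v0).
have q0 : 0 <= 4 * v + 3 * v ^+ 2 + v ^+ 3 by rewrite !addr_ge0 ?mulr_ge0 ?exprn_ge0 // ltW.
have s : 1 - v ^+ 2 - 1 / 3 * (4 * v + 3 * v ^+ 2 + v ^+ 3) <= slack v w.
  by rewrite /slack lerD2l lerN2 ler_wpM2r.
have d : 1 <= (1 - v ^+ 2 - 1 / 3 * (4 * v + 3 * v ^+ 2 + v ^+ 3)) * (1 + 9%:R * v).
  nra.
have s0 : 0 <= 1 - v ^+ 2 - 1 / 3 * (4 * v + 3 * v ^+ 2 + v ^+ 3).
  nra.
apply: le_trans d _; apply: ler_pM => //.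
by rewrite addr_ge0 // mulr_ge0 // ltW.
Qed.

(** The bound on [w] is [14 * t <= n - 2 * k] rewritten in [v] and [w]. *)
Lemma slack_t2_large v w : 1 / 3 <= v -> v < 1 -> w * (15 * v - 1) <= 1 - v ->
  4 / 5 * (1 - v) <= slack v w.
Proof.
move=> v0 v1 hw.
have q0 : 0 < 15 * v - 1 by lra.
rewrite -(ler_pM2r q0) /slack.
have : w * (15 * v - 1) * (4 * v + 3 * v ^+ 2 + v ^+ 3) <= (1 - v) * (4 * v + 3 * v ^+ 2 + v ^+ 3).
  by rewrite ler_wpM2r // !addr_ge0 ?mulr_ge0 ?exprn_ge0 //; lra.
suff : 0 <= (1 - v) * (12 * v ^+ 2 - 2 * v - 1 / 5 - v ^+ 3) by nra.
rewrite mulr_ge0 //; nra.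
Qed.

(** This is [slack_t1_large] cleared of denominators. *)
Lemma quintic_t1 k u : (30 <= k -> 5 <= u ->
  (k + u) ^ 3 * (k - 1) + k * (8 * k ^ 3 + 11 * k ^ 2 * u + 4 * k * u ^ 2)
    <= k * ((k - 1) * (k + u) * u * (2 * k + u)))%N.
Proof.
move=> k30 u5; rewrite -(subnK k30) -(subnK u5).
move: (k - 30)%N (u - 5)%N => c a; have -> : (c + 30 - 1 = c + 29)%N by lia.
nia.
Qed.

Lemma slack_t1_large k u : (30 <= k)%N -> (5 <= u)%N ->
  1 <= slack (k%:R / (k + u)%:R : R) (1 / (k - 1)%:R) * k%:R.
Proof.
move=> k30 u5; have := quintic_t1 k30 u5.
rewrite -(ler_nat R) !(natrD, natrM, natrX) natrB; last by lia.
have : 30 <= k%:R :> R by rewrite ler_nat.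
have : 5 <= u%:R :> R by rewrite ler_nat.
move: (k%:R : R) (u%:R : R) => {k30 u5} x y y5 x30 h.
have D0 : 0 < (x + y) ^+ 3 * (x - 1) by rewrite mulr_gt0 ?exprn_gt0 //; lra.
rewrite -(ler_pM2r D0) [X in X <= _]mul1r.
have -> : slack (x / (x + y)) (1 / (x - 1)) * x * ((x + y) ^+ 3 * (x - 1))
    = x * ((x - 1) * (x + y) * y * (2 * x + y)) - x * (8 * x ^+ 3 + 11 * x ^+ 2 * y + 4 * x * y ^+ 2).
  by rewrite /slack; field; rewrite !lt0r_neq0 //; lra.
by rewrite lerBrDr.
Qed.

(** For [m = k - 6] the left side is [k], and [9 / 5] is [1 + v] at the splitting point
    [v = 4 / 5]. *)
Lemma exp_linear m : (4 <= m)%N -> (m + 6)%:R <= (9 / 5 : R) ^+ m.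
Proof.
move=> /subnK <-; elim: (m - 4)%N => [|d IH]; first by rewrite add0n !exprS expr0; lra.
rewrite addSn exprS; apply: le_trans (ler_wpM2l _ IH); last lra.
have : 0 <= d%:R :> R by [].
by rewrite addSn -natr1 !natrD; lra.
Qed.

Lemma slack_bound n k t : admissible n k t ->
  1 <= slack (k%:R / (n - k)%:R : R) (t%:R / (k - t)%:R)
       * (1 + k%:R / (n - k)%:R) ^+ (k - 5 - t).
Proof.
move=> hyp; pose u : R := (n - 2 * k)%:R.
have [k0 nk tk] : [/\ 0 < k, 2 * k < n & 4 * t + 8 <= k]%N by case: hyp => -[*]; split; lia.
have -> : (n - k)%:R = k%:R + u :> R by rewrite -natrD; congr _%:R; lia.
have kR : 0 < k%:R :> R by rewrite ltr0n.
have u0 : 0 < u by rewrite ltr0n subn_gt0.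
have ku : 0 < k%:R + u by lra.
have v0 : 0 < k%:R / (k%:R + u) by rewrite divr_gt0.
have v1 : k%:R / (k%:R + u) < 1 by rewrite ltr_pdivrMr //; lra.
have kt : (k - t)%:R = k%:R - t%:R :> R by rewrite natrB //; lia.
case: hyp => -[ht1 ht2 ht3].
  have k30 : 30 <= k%:R :> R by rewrite ler_nat.
  have u5 : 5 <= u by rewrite ler_nat; lia.
  have [vs|vl] := lerP (k%:R / (k%:R + u)) (4 / 5).
    apply: slack_t1_small => //; first by lia.
    by rewrite kt ht1 ler_pdivrMr; lra.
  have h : 1 <= slack (k%:R / (k%:R + u)) (t%:R / (k - t)%:R) * k%:R.
    by rewrite ht1 -natrD; apply: slack_t1_large => //; lia.
  have s0 : 0 <= slack (k%:R / (k%:R + u)) (t%:R / (k - t)%:R).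
    by rewrite -(pmulr_lge0 _ kR); apply: le_trans h.
  apply: le_trans h _; rewrite ht1 in s0 *.
  rewrite ler_wpM2l //; apply: le_trans (_ : (9 / 5) ^+ (k - 5 - 1) <= _).
    by apply: le_trans (exp_linear _); rewrite ?ler_nat; clear - ht3; lia.
  by rewrite lerXn2r ?nnegrE //; lra.
have t0R : 1 < t%:R :> R by rewrite ltr1n.
have ktR : 4 * t%:R + 8 <= k%:R :> R by rewrite -!natrM -natrD ler_nat.
have utR : 14 * t%:R <= u by rewrite /u -natrM ler_nat; lia.
have [vs|vl] := lerP (k%:R / (k%:R + u)) (1 / 3).
  apply: slack_t2_small => //; first by lia.
  by rewrite kt ler_pdivrMr; lra.
apply: (@le_trans _ _ (4 / 5 * (1 - k%:R / (k%:R + u)) * (1 + k%:R / (k%:R + u)) ^+ (k - 5 - t))).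
  have m0 : (k - 5 - t)%:R = k%:R - 5 - t%:R :> R by rewrite -subnDA natrB ?natrD ?opprD ?addrA //; lia.
  have h := bernoulli_le (leqnn (k - 5 - t)) (ltW v0) (ltW vl) (_ : 0 <= 1 / 3).
  have {}h : 1 + (k%:R - 5 - t%:R) * (1 / 3) <= (1 + k%:R / (k%:R + u)) ^+ (k - 5 - t).
    by rewrite -m0 h //; lra.
  have p : 0 <= 4 / 5 * (1 - k%:R / (k%:R + u)) by lra.
  apply: le_trans (ler_wpM2l p h).
  rewrite -(ler_pM2r ku) [X in X <= _]mul1r.
  have -> : 4 / 5 * (1 - k%:R / (k%:R + u)) * (1 + (k%:R - 5 - t%:R) * (1 / 3)) * (k%:R + u)
    = 4 / 5 * u * (1 + (k%:R - 5 - t%:R) * (1 / 3)) :> R by field; rewrite lt0r_neq0.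
  have t2 : 2 <= t%:R :> R by rewrite ler_nat.
  nra.
rewrite ler_wpM2r ?exprn_ge0 //; first by lra.
apply: slack_t2_large => //; first exact: ltW.
rewrite kt -(@ler_pM2r _ ((k%:R + u) * (k%:R - t%:R))); last by rewrite mulr_gt0; lra.
have -> : t%:R / (k%:R - t%:R) * (15 * (k%:R / (k%:R + u)) - 1) * ((k%:R + u) * (k%:R - t%:R))
   = t%:R * (14 * k%:R - u) :> R by field; rewrite !lt0r_neq0; lra.
have -> : (1 - k%:R / (k%:R + u)) * ((k%:R + u) * (k%:R - t%:R)) = u * (k%:R - t%:R) :> R.
  by field; rewrite lt0r_neq0.
nra.
Qed.

(** The product equals [1 - slack v w / (1 + v) ^+ 4], which is where the formula of [slack] comes
    from. *)
Lemma slack_weight v w m : 0 < v -> 1 <= slack v w * (1 + v) ^+ m ->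
  (1 - (1 - v) / (1 + v) ^+ 3) * (1 + w / (1 + v)) + (1 + v)^-1 ^+ (m + 4) <= 1.
Proof.
move=> v0 h; have s0 : 0 < 1 + v by rewrite ltr_wpDr // ltW.
have Z0 : 0 < (1 + v) ^+ m by rewrite exprn_gt0.
have -> : (1 - (1 - v) / (1 + v) ^+ 3) * (1 + w / (1 + v)) = 1 - slack v w / (1 + v) ^+ 4.
  by rewrite /slack; field; rewrite lt0r_neq0.
rewrite exprD !exprVn.
suff : ((1 + v) ^+ m)^-1 * ((1 + v) ^+ 4)^-1 <= slack v w / (1 + v) ^+ 4 by lra.
rewrite ler_wpM2r ?invr_ge0 ?exprn_ge0 ?(ltW s0) //.
by rewrite -(ler_pM2r Z0) mulVf // lt0r_neq0.
Qed.

(** Here [f] is the size of the family, [b] the number of sets missing the vertex and [C] the full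
    star. The bound [b <= f / (1 + v)] reduces [f + w * b] to a multiple of [f]. *)
Lemma average_large_field (f b C W X v w kt : R) m : 0 < v -> 0 <= w -> 0 < kt -> 0 <= W -> 0 <= C ->
  1 <= slack v w * (1 + v) ^+ m ->
  f <= (1 - (1 - v) / (1 + v) ^+ 3) * C -> b <= f / (1 + v) ->
  X <= (1 + v)^-1 ^+ (m + 4) * (C * W) ->
  kt * f * W + (w * kt) * b * W + kt * X <= kt * C * W.
Proof.
move=> v0 w0 kt0 W0 C0 /(slack_weight v0) hs hf hb hX.
have s0 : 0 < 1 + v by rewrite ltr_wpDr // ltW.
have -> : kt * f * W + (w * kt) * b * W + kt * X = kt * ((f + w * b) * W + X) by ring.
rewrite -mulrA ler_pM2l //; apply: le_trans (lerD (lexx _) hX) _.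
rewrite mulrA -mulrDl ler_wpM2r //.
have h1 : f + w * b <= (1 - (1 - v) / (1 + v) ^+ 3) * (1 + w / (1 + v)) * C.
  apply: (@le_trans _ _ (f * (1 + w / (1 + v)))).
    by rewrite mulrDr mulr1 lerD2l mulrCA ler_wpM2l.
  by rewrite [X in _ <= X]mulrAC ler_wpM2r // addr_ge0 // divr_ge0 // ltW.
apply: le_trans (lerD h1 (lexx _)) _; rewrite -mulrDl.
by rewrite -[X in _ <= X]mul1r ler_wpM2r.
Qed.

Lemma average_large_nat n k t (f b C W X : nat) : (t < k)%N -> (0 < k)%N -> (k < n)%N -> (t + 5 <= k)%N ->
  1 <= slack (k%:R / (n - k)%:R : R) (t%:R / (k - t)%:R)
       * (1 + k%:R / (n - k)%:R) ^+ (k - 5 - t) ->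
  (f * n ^ 3 + (n - 2 * k) * (n - k) ^ 2 * C <= n ^ 3 * C)%N ->
  (n * b <= (n - k) * f)%N ->
  (X * n ^ (k - t - 1) <= (n - k) ^ (k - t - 1) * (C * W))%N -> (2 * k <= n)%N ->
  ((k - t) * f * W + t * b * W + (k - t) * X <= (k - t) * C * W)%N.
Proof.
move=> tk k0 kn t5 hs hf hb hX k2.
rewrite -(ler_nat R) !(natrD, natrM).
have nkR : 0 < (n - k)%:R :> R by rewrite ltr0n subn_gt0.
have ktR : 0 < (k - t)%:R :> R by rewrite ltr0n subn_gt0.
have nR : 0 < n%:R :> R by rewrite ltr0n; lia.
have v1 : 1 + k%:R / (n - k)%:R = n%:R / (n - k)%:R :> R.
  have -> : n%:R = (n - k)%:R + k%:R :> R by rewrite -natrD; congr _%:R; lia.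
  by rewrite mulrDl divff // lt0r_neq0.
have -> : t%:R = t%:R / (k - t)%:R * (k - t)%:R :> R by rewrite divfK // lt0r_neq0.
apply: (@average_large_field _ _ _ _ _ (k%:R / (n - k)%:R) _ _ (k - 5 - t)) => //.
- by rewrite divr_gt0 // ltr0n.
- by rewrite divr_ge0.
- rewrite v1 -(@ler_pM2r _ (n%:R ^+ 3)) ?exprn_gt0 //.
  have -> : 1 - k%:R / (n - k)%:R = (n - 2 * k)%:R / (n - k)%:R :> R.
    have -> : (n - 2 * k)%:R = (n - k)%:R - k%:R :> R.
      by rewrite -natrB; [congr _%:R|]; lia.
    by rewrite mulrBl divff // lt0r_neq0.
  have -> : (1 - (n - 2 * k)%:R / (n - k)%:R / (n%:R / (n - k)%:R) ^+ 3) * C%:R * n%:R ^+ 3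
     = n%:R ^+ 3 * C%:R - (n - 2 * k)%:R * (n - k)%:R ^+ 2 * C%:R :> R.
    by field; rewrite !lt0r_neq0.
  by rewrite lerBrDr -!(natrX, natrM, natrD) ler_nat.
- by rewrite v1 invf_div mulrA ler_pdivlMr // mulrC [f%:R * _]mulrC -!natrM ler_nat.
rewrite v1 invf_div; have -> : (k - 5 - t + 4 = k - t - 1)%N by lia.
rewrite -(@ler_pM2r _ (n%:R ^+ (k - t - 1))) ?exprn_gt0 // expr_div_n mulrAC divfK.
  by rewrite -!(natrX, natrM) ler_nat.
by rewrite expf_neq0 // lt0r_neq0.
Qed.

End Core.

(** The quotient of the binomials is a product of three explicit ratios. The factor [n - k - 1] is
    kept because it cancels against the one in [far_from_star]. *)
Lemma bin_third_ratio n k : (2 < k -> 2 * k <= n ->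
  (n - k) ^ 2 * (n - k - 1) * 'C(n - 1, k - 1) <= n ^ 3 * 'C(n - 4, k - 1))%N.
Proof.
move=> k3 kn.
have e1 : ((n - 1) * 'C(n - 2, k - 1) = (n - k) * 'C(n - 1, k - 1))%N.
  by have := mul_bin_down (n - 1) (k - 1); rewrite -subn1 -subnDA => ->; congr (_ * _)%N; lia.
have e2 : ((n - 2) * 'C(n - 3, k - 1) = (n - k - 1) * 'C(n - 2, k - 1))%N.
  by have := mul_bin_down (n - 2) (k - 1); rewrite -subn1 -subnDA => ->; congr (_ * _)%N; lia.
have e3 : ((n - 3) * 'C(n - 4, k - 1) = (n - k - 2) * 'C(n - 3, k - 1))%N.
  by have := mul_bin_down (n - 3) (k - 1); rewrite -subn1 -subnDA => ->; congr (_ * _)%N; lia.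
have e : ((n - 1) * (n - 2) * (n - 3) * 'C(n - 4, k - 1)
    = (n - k) * (n - k - 1) * (n - k - 2) * 'C(n - 1, k - 1))%N.
  transitivity ((n - 1) * (n - 2) * ((n - 3) * 'C(n - 4, k - 1)))%N; first by ring.
  rewrite e3; transitivity ((n - 1) * (n - k - 2) * ((n - 2) * 'C(n - 3, k - 1)))%N; first by ring.
  rewrite e2; transitivity ((n - k - 1) * (n - k - 2) * ((n - 1) * 'C(n - 2, k - 1)))%N; first by ring.
  by rewrite e1; ring.
have pos : (0 < (n - 1) * (n - 2) * (n - 3))%N by rewrite !muln_gt0; lia.
have poly : ((n - k) * ((n - 1) * (n - 2) * (n - 3)) <= n ^ 3 * (n - k - 2))%N.
  have -> : (n - k = n - k - 2 + 2)%N by lia.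
  have : (n <= 2 * (n - k - 2) + 4)%N by lia.
  have n6 : (6 <= n)%N by lia.
  move: (n - k - 2)%N => q; rewrite addnK -(subnK n6); move: (n - 6)%N => j hq.
  have -> : (j + 6 - 1 = j + 5)%N by lia.
  have -> : (j + 6 - 2 = j + 4)%N by lia.
  have -> : (j + 6 - 3 = j + 3)%N by lia.
  nia.
rewrite -(leq_pmul2l pos).
have -> : ((n - 1) * (n - 2) * (n - 3) * (n ^ 3 * 'C(n - 4, k - 1))
   = n ^ 3 * (n - k - 2) * ((n - k) * (n - k - 1) * 'C(n - 1, k - 1)))%N.
  by rewrite mulnCA e; ring.
apply: leq_trans (leq_mul poly (leqnn _)).
by apply: eq_leq; ring.
Qed.

Lemma average_large_diversity n k t a b : admissible n k t ->
  ((n - 2 * k) * 'C(n - 4, k - 1) + (n - k - 1) * (a + b) <= (n - k - 1) * 'C(n - 1, k - 1) ->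
  n * b <= (n - k) * (a + b) ->
  a * 'C(k - 1, t) + b * 'C(k, t) <=
    ('C(n - t - 1, k - t - 1) - 'C(n - t - k - 1, k - t - 1)) * 'C(n - 1, t))%N.
Proof.
move=> hyp hf hb; have hs := slack_bound rat hyp.
have [t0 tk k3 kn] : [/\ 0 < t, 4 * t + 8 <= k, 2 < k & 2 * k < n]%N.
  by case: hyp => -[*]; split; lia.
apply: average_transfer; [lia|lia|].
set W := 'C(k - 1, t); set C := 'C(n - 1, k - 1) in hf *.
set X := ('C(n - 1, t) * _)%N; pose f := (a + b)%N.
(* Each of the [k - t - 1] factors shrinks by at least [(n - k) / n] when the points of a [k]-set
   are forbidden. *)
have hX : (X * n ^ (k - t - 1) <= (n - k) ^ (k - t - 1) * (C * W))%N.
  have h : ('C(n - t - k - 1, k - t - 1) * n ^ (k - t - 1)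
      <= 'C(n - t - 1, k - t - 1) * (n - k) ^ (k - t - 1))%N.
    apply: bin_ratio => i _; have -> : (n - t - k - 1 - i = n - t - 1 - i - k)%N by lia.
    have : (n - t - 1 - i <= n)%N by lia.
    move: (n - t - 1 - i)%N => q qn; rewrite mulnBl mulnBr leq_sub2l //.
    by rewrite [(q * k)%N]mulnC leq_mul2l qn orbT.
  have tri : (C * W = 'C(n - 1, t) * 'C(n - t - 1, k - t - 1))%N by apply: star_trinomial; lia.
  rewrite tri /X -mulnA; apply: leq_trans (leq_mul (leqnn _) h) _.
  by apply: eq_leq; ring.
have {}hf : (f * n ^ 3 + (n - 2 * k) * (n - k) ^ 2 * C <= n ^ 3 * C)%N.
  have M0 : (0 < n - k - 1)%N by lia.
  have h := leq_mul (leqnn (n - 2 * k)) (bin_third_ratio k3 (ltnW kn)).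
  rewrite -(leq_pmul2l M0) mulnDr addnC.
  have -> : ((n - k - 1) * (n ^ 3 * C) = n ^ 3 * ((n - k - 1) * C))%N by ring.
  apply: leq_trans (leq_mul (leqnn _) hf); rewrite [X in (_ <= X)%N]mulnDr; apply: leq_add.
    have -> : (n ^ 3 * ((n - 2 * k) * 'C(n - 4, k - 1))
      = (n - 2 * k) * (n ^ 3 * 'C(n - 4, k - 1)))%N by ring.
    by apply: leq_trans h; apply: eq_leq; rewrite /C; ring.
  by apply: eq_leq; rewrite /f; ring.
have -> : ((k - t) * a * W + k * b * W + (k - t) * X = (k - t) * f * W + t * b * W + (k - t) * X)%N.
  have ek : k = (k - t + t)%N by lia.
  by rewrite [X in (_ + X * b * W + _)%N]ek /f; ring.
by apply: (average_large_nat _ _ _ _ hs hf hb hX); lia.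
Qed.

(** * The bound, by the number of sets missing the most popular vertex *)

Theorem theorem5 (n k t : nat) (F : {set {set 'I_n}}) :
  0 < n -> 0 < k -> 0 < t ->
  [/\ t = 1, 2 * k + 5 <= n & 30 <= k] \/
  [/\ 1 < t, 4 * (t + 2) <= k & 2 * k + 14 * t <= n] ->
  uniform k F -> intersecting F -> nontrivial F ->
  min_degree t F <=
    'C(n - t - 1, k - t - 1) - 'C(n - t - k - 1, k - t - 1).
Proof.
move=> n0 _ t0 hyp uF iF ntF.
have [k3 tk tn] : [/\ 2 < k, t.+1 < k & t + 2 * k <= n].
  by case: hyp => -[*]; split; lia.
have le2kn : 2 * k <= n by lia.
pose missing (x : 'I_n) := #|trace F [set x] set0|.
(* Minimality serves the last range: every vertex is then missed by many sets, and
   [diversity_average] applies. *)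
have [x min_x] : exists x, forall y, missing x <= missing y.
  by case: (arg_minnP missing (erefl : predT (Ordinal n0))) => x _ min_x; exists x => y; apply: min_x.
have missing_x : 0 < missing x.
  rewrite lt0n; apply/eqP=> /eqP; rewrite cards_eq0 => /eqP/setP F0.
  suff : x \in \bigcap_(A in F) A by rewrite ntF inE.
  by apply/bigcapP=> A AF; move: (F0 A); rewrite mem_trace0 AF in_set0 => /negbFE.
have [tiny|big] := leqP (missing x) ('C(n - k - t - 2, k - t - 2) + 2).
  have [S cS hS] := degree_small_diversity uF iF t0 tn tk missing_x tiny.
  exact: leq_trans (min_degree_le F cS) hS.
have Cpos : 0 < 'C(n - 1, t) by rewrite bin_gt0; lia.
rewrite -(leq_pmul2r Cpos); apply: leq_trans (min_degree_sum t uF x) _.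
have [small|large] := leqP (missing x) 'C(n - 3, k - 2).
  apply: average_small_diversity => //; first exact: star_small.
  apply: star_large => //; first by lia.
  apply: leq_trans _ (ltnW big); rewrite -bin_sub; last by lia.
  have -> : n - k + 2 * t + 1 - (n - k - 1) = 2 * t + 2 by lia.
  exact: bin_threshold.
apply: average_large_diversity => //.
  rewrite [_ + #|trace F [set x] set0|]addnC -card_star_split.
  by apply: diversity_bound => // y; apply: leq_trans large (min_x y).
by rewrite [in X in _ <= _ * X]addnC -card_star_split; apply: diversity_average.
Qed.
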